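(* Let $d\ge2$. There is a $C>0$ such that for all $n\ge1$, $$\mu^{2n}e^{-C\sqrt{n}}\le c_{2n+1}(e_1)\le (n+1)\mu^{2n+2}.$$ In particular, $\mu_{\mathrm{Polygon}}=\mu$.
   Context: An $n$-step self-avoiding walk (SAW) on $\mathbb{Z}^d$ is a sequence $\omega=(\omega(0),\dots,\omega(n))$ of pairwise distinct points of $\mathbb{Z}^d$ with $\|\omega(j)-\omega(j-1)\|_1=1$ for $j=1,\dots,n$. $c_n$ is the number of $n$-step SAWs with $\omega(0)=0$; $c_n(x)$ is the number of these with $\omega(n)=x$; $e_1=(1,0,\dots,0)$; and $\mu=\lim_{n\to\infty}c_n^{1/n}$ is the connective constant. A $2n$-step self-avoiding return is a nearest-neighbour walk with $\omega(0)=\omega(2n)=0$ and $\omega(i)\neq\omega(j)$ for all distinct pairs $i,j$ other than the pair $0,2n$. A self-avoiding polygon is a self-avoiding return with orientation and location of the origin forgotten; the number of $2n$-step self-avoiding polygons (up to translation) is $$q_{2n}=\frac{2d\,c_{2n-1}(e_1)}{2\cdot 2n}\qquad(n\ge2).$$ The limit $\mu_{\mathrm{Polygon}}=\lim_{n\to\infty}q_{2n}^{1/(2n)}$ exists. *)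

(* Defs.v *)
From mathcomp Require Import all_boot all_order all_algebra finmap.
From mathcomp Require Import all_classical all_reals all_analysis.

Set Implicit Arguments.
Unset Strict Implicit.
Unset Printing Implicit Defensive.

Import Order.TTheory GRing.Theory Num.Theory.
Import numFieldNormedType.Exports.

Local Open Scope classical_set_scope.
Local Open Scope ring_scope.

Definition lattice (d : nat) := 'rV[int]_d.

Definition norm1 d (x : lattice d) : int := \sum_(i < d) `|x 0 i|.

Definition e1 d : lattice d := \row_(i < d) (i == 0 :> nat)%:R.

(* The sequence (w(0), ..., w(n)). *)
Definition path_of (d n : nat) := {ffun 'I_n.+1 -> lattice d}.

(* [lift ord0 j] and [widen_ord _ j] are the indices j + 1 and j. *)
Definition nearest_neighbour d n (w : path_of d n) : Prop :=
  forall j : 'I_n, norm1 (w (lift ord0 j) - w (widen_ord (leqnSn n) j)) = 1.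

Definition self_avoiding_walk d n (w : path_of d n) : Prop :=
  nearest_neighbour w /\ injective w.

(* [fset_set A] enumerates A when A is finite, as are all the sets of paths
   counted below: a nearest-neighbour walk from 0 has (2 d) ^ n choices. *)
Definition saw_count (d n : nat) : nat :=
  #|` fset_set [set w : path_of d n | self_avoiding_walk w /\ w ord0 = 0] |.

Definition saw_count_to (d n : nat) (x : lattice d) : nat :=
  #|` fset_set [set w : path_of d n |
        [/\ self_avoiding_walk w, w ord0 = 0 & w ord_max = x]] |.

Definition self_avoiding_return d m (w : path_of d m) : Prop :=
  [/\ nearest_neighbour w, w ord0 = 0, w ord_max = 0
    & forall i j : 'I_m.+1, (i < j)%N -> (i, j) != (ord0, ord_max) ->
        w i != w j].

(* Two m-step returns trace the same polygon up to translation when one is, up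
   to a translation x, the other read from its k-th site on, forwards or
   backwards.  Indices are taken modulo m, as w(m) = w(0). *)
Definition same_polygon d m (w w' : path_of d m) : Prop :=
  exists (k : nat) (x : lattice d),
    (forall i : 'I_m.+1, w' i = w (inord ((k + i) %% m)) + x) \/
    (forall i : 'I_m.+1, w' i = w (inord ((k + (m - i)) %% m)) + x).

Definition polygon_class d m (w : path_of d m) : set (path_of d m) :=
  [set w' | self_avoiding_return w' /\ same_polygon w w'].

Definition polygons (d m : nat) : set (set (path_of d m)) :=
  [set polygon_class w | w in [set w | self_avoiding_return w]].

(* For even m >= 4 each class has 2 m elements, whence the usual formula
   q_m = 2 d c_(m - 1)(e1) / (2 m). *)
Definition polygon_count (d m : nat) : nat := #|` fset_set (@polygons d m) |.

(* [limn] of a divergent real sequence is 0, so equating such a limit with a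
   positive number also asserts convergence. *)
Definition connective_constant (R : realType) (d : nat) : R :=
  limn (fun n : nat => (saw_count d n)%:R `^ n%:R^-1 : R).

Definition polygon_connective_constant (R : realType) (d : nat) : R :=
  limn (fun n : nat => (polygon_count d (2 * n))%:R `^ (2 * n)%:R^-1 : R).

(* Main.v *)
Require Import Defs.
From mathcomp Require Import all_boot all_order all_algebra finmap.
From mathcomp Require Import all_classical all_reals all_analysis.
From mathcomp Require Import zify ring lra.

(* Encode walks as words in the 2 d unit steps, so that concatenation, reversal,
   reflection and change of root are list operations.  Call a self-avoiding word
   a bridge for a linear functional when it is lowest only at its start and
   highest at its end; bridges concatenate, so their numbers are
   supermultiplicative and the number of n-step bridges is at most mu ^ n.

   Upper bound.  Choose a functional that separates the points of a large box.  A
   return, rooted at its lowest point and cut at its highest one, is a pair of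
   bridges with the same displacement x; their concatenation is a bridge with
   displacement 2 x, from which the cut is recovered as the only visit to x.
   Hence there are at most 2 n mu ^ (2 n) returns of length 2 n.  Each walk to e1
   closes up to a return, and so does its opposite, which saves the factor 2.

   Lower bound.  By Hammersley and Welsh, cutting a half-space walk at its last
   highest point, reflecting what follows and iterating yields a bridge.  The
   pieces have decreasing heights summing to at most n, so weighting a bridge of
   height h by x ^ (- h) bounds the loss by x ^ (- n) \prod_i (1 + x ^ i), which is
   at most exp (2 sqrt n) for x = sqrt n / (sqrt n + 1).  Two bridges with the same
   displacement x, re-rooted at extreme points for a functional vanishing at x,
   lie on either side of a hyperplane and close up to a polygon.  This costs only
   polynomial factors. *)

Set Implicit Arguments.
Unset Strict Implicit.
Unset Printing Implicit Defensive.

Import Order.TTheory GRing.Theory Num.Theory.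
Import numFieldNormedType.Exports.
Local Open Scope ring_scope.

(** Two cuts of one word are nested. This case analysis drives every later argument about factors of
    a concatenation. *)
Lemma cat_eq_cat (T : Type) (u w p q : seq T) : u ++ w = p ++ q ->
  (exists2 r, p = u ++ r & w = r ++ q) \/ (exists2 r, u = p ++ r & q = r ++ w).
Proof.
elim: u p => [|a u IHu] [|b p] /=.
- by move=> ->; left; exists [::].
- by move=> ->; left; exists (b :: p).
- by move=> <-; right; exists (a :: u).
by case=> -> /IHu [[r -> ->]|[r -> ->]]; [left|right]; exists r.
Qed.

Lemma map_eq_cat (T T' : Type) (f : T -> T') (s : seq T) (p q : seq T') :
  map f s = p ++ q -> exists p' q', [/\ s = p' ++ q', p = map f p' & q = map f q'].
Proof.
move=> e; exists (take (size p) s), (drop (size p) s).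
by rewrite cat_take_drop map_take map_drop e take_size_cat // drop_size_cat.
Qed.

Lemma rev_eq_cat (T : Type) (s p q : seq T) : rev s = p ++ q ->
  s = rev q ++ rev p.
Proof. by move=> e; rewrite -rev_cat -e revK. Qed.

(** * Walks as words *)

Section Words.
Variable d : nat.
Implicit Types (c : 'I_d -> int) (s p q u w : seq ('I_d * bool)).

(* The letter (i, false) is the unit step e_i and (i, true) is - e_i; a word
   stands for the walk from 0 that takes its letters as steps. *)
Definition vec (a : 'I_d * bool) : 'rV[int]_d := (-1) ^+ a.2 *: delta_mx 0 a.1.

Definition disp s : 'rV[int]_d := \sum_(a <- s) vec a.

Definition flip (a : 'I_d * bool) := (a.1, ~~ a.2).

Definition refl (k : 'I_d) (a : 'I_d * bool) := if a.1 == k then flip a else a.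

Definition ht c s : int := \sum_i disp s 0 i * c i.

Lemma disp_nil : disp [::] = 0. Proof. by rewrite /disp big_nil. Qed.

Lemma disp_cat u w : disp (u ++ w) = disp u + disp w.
Proof. by rewrite /disp big_cat. Qed.

Lemma disp_cons a s : disp (a :: s) = vec a + disp s.
Proof. by rewrite /disp big_cons. Qed.

Lemma disp_rev s : disp (rev s) = disp s.
Proof. by rewrite /disp; apply/perm_big; rewrite perm_rev. Qed.

Lemma vec_flip a : vec (flip a) = - vec a.
Proof. by rewrite /vec/= signrN scaleNr. Qed.

Lemma flipK : involutive flip.
Proof. by case=> i b; rewrite /flip /= negbK. Qed.

Lemma flipP a : flip a != a.
Proof. by case: a => i b; apply/eqP => -[] /eqP; case: b. Qed.

Lemma reflK k : involutive (refl k).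
Proof.
move=> a; rewrite /refl; case: (boolP (a.1 == k)) => [ak|/negPf -> //].
by rewrite /= ak flipK.
Qed.

Lemma disp_flip s : disp (map flip s) = - disp s.
Proof.
by rewrite /disp big_map -sumrN; apply: eq_bigr => a _; rewrite vec_flip.
Qed.

Lemma disp_refl k s i :
  disp (map (refl k) s) 0 i = (-1) ^+ (i == k) * disp s 0 i.
Proof.
rewrite /disp big_map !summxE mulr_sumr; apply: eq_bigr => a _.
rewrite /refl; case: (a.1 =P k) => [ak|ak]; last first.
  case: (i =P k) => [ik|_]; last by rewrite mul1r.
  have /negPf e : i != a.1 by apply/eqP => e; apply: ak; rewrite -e.
  by rewrite /vec !mxE e andbF !mulr0.
rewrite vec_flip mxE; case: (i =P k) => [_|ik]; first by rewrite mulN1r.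
have /negPf e : i != a.1 by apply/eqP => e; apply: ik; rewrite e.
by rewrite /vec !mxE e andbF !mulr0 oppr0 ?mul1r.
Qed.

Lemma ht0 c u : disp u = 0 -> ht c u = 0.
Proof. by rewrite /ht => ->; apply: big1 => i _; rewrite mxE mul0r. Qed.

Lemma ht_nil c : ht c [::] = 0. Proof. exact/ht0/disp_nil. Qed.

Lemma ht_cat c u w : ht c (u ++ w) = ht c u + ht c w.
Proof.
by rewrite -big_split /=; apply: eq_bigr => i _; rewrite disp_cat mxE mulrDl.
Qed.

Lemma ht_rev c s : ht c (rev s) = ht c s.
Proof. by rewrite /ht disp_rev. Qed.

Lemma ht_flip c s : ht c (map flip s) = - ht c s.
Proof.
by rewrite /ht -sumrN; apply: eq_bigr => i _; rewrite disp_flip mxE mulNr.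
Qed.

Lemma ht_vec c a : ht c [:: a] = (-1) ^+ a.2 * c a.1.
Proof.
rewrite /ht disp_cons disp_nil addr0 (bigD1 a.1) //= big1 ?addr0 => [|i ia].
  by rewrite /vec !mxE !eqxx mulr1.
by rewrite /vec !mxE (negPf ia) andbF mulr0 mul0r.
Qed.

Lemma ht_cons c a s : ht c (a :: s) = (-1) ^+ a.2 * c a.1 + ht c s.
Proof. by rewrite -cat1s ht_cat ht_vec. Qed.

(* Equivalently, the points visited are pairwise distinct. *)
Definition saw s := forall p u q, s = p ++ u ++ q -> disp u = 0 -> u = [::].

(** A closed factor inside [u] or inside [w] is already excluded, so only factors straddling the
    junction need a hypothesis. *)
Lemma saw_cat u w : saw u -> saw w ->
  (forall p u' w' q, u = p ++ u' -> w = w' ++ q -> u' <> [::] -> w' <> [::] ->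
    disp u' + disp w' <> 0) ->
  saw (u ++ w).
Proof.
move=> su sw uw p f q /cat_eq_cat [[r _ e]|[r e1 e2]] f0; first exact: sw e f0.
case/cat_eq_cat: e2 => [[r' er _]|[r' ef ew]].
  by apply: (su p f r') => //; rewrite e1 er.
case: r e1 ef => [|a r] e1 ef; first by rewrite /= in ef; subst r'; exact: (sw [::] f q).
case: r' ef ew => [|b r'] ef ew.
  by rewrite cats0 in ef; subst f; apply: (su p _ [::]); rewrite ?cats0.
by move: f0; rewrite ef disp_cat => /(uw p (a :: r) (b :: r') q e1 ew); case.
Qed.

Lemma saw_factor p u q : saw (p ++ u ++ q) -> saw u.
Proof.
move=> s p' u' q' e; apply: (s (p ++ p') _ (q' ++ q)).
by rewrite e -!catA.
Qed.

Lemma saw_catl u w : saw (u ++ w) -> saw u.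
Proof. exact: (@saw_factor [::]). Qed.

Lemma saw_catr u w : saw (u ++ w) -> saw w.
Proof. by move=> s; apply: (@saw_factor u w [::]); rewrite cats0. Qed.

Lemma saw_rev s : saw s -> saw (rev s).
Proof.
move=> ss p u q e u0; apply: (can_inj revK).
apply: (ss (rev q) (rev u) (rev p)); last by rewrite disp_rev.
by rewrite -(revK s) e !rev_cat catA.
Qed.

(** The inverse [g] carries a closed factor of the image back to a closed factor of [s]. *)
Lemma saw_map (f g : 'I_d * bool -> 'I_d * bool) s : cancel f g ->
  (forall u, disp u = 0 -> disp (map g u) = 0) -> saw s -> saw (map f s).
Proof.
move=> fK g0 ss p u q e /g0 u0.
suff: map g u = [::] by case: (u).
apply: (ss (map g p) _ (map g q)) => //.
by rewrite -!map_cat -e mapK.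
Qed.

Lemma saw_flip s : saw s -> saw (map flip s).
Proof. by apply: saw_map flipK _ => u u0; rewrite disp_flip u0 oppr0. Qed.

Lemma saw_refl k s : saw s -> saw (map (refl k) s).
Proof.
apply: saw_map (reflK k) _ => u u0; apply/rowP => i.
by rewrite disp_refl u0 !mxE mulr0.
Qed.

(** * Heights and bridges *)

Definition climbing c s := forall p q, s = p ++ q -> p <> [::] -> 0 < ht c p.

(** The end is a highest point, ties allowed, whereas [climbing] is strict at the start. With
    strictness on one side only, factors across a junction of bridges already have positive
    height. *)
Definition capped c s := forall p q, s = p ++ q -> 0 <= ht c q.

Definition bridge c s := [/\ saw s, climbing c s & capped c s].

Lemma bridge_ht_ge0 c s : bridge c s -> 0 <= ht c s.
Proof. by case=> _ _ /(_ [::] s); apply. Qed.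

Lemma bridge_nil c : bridge c [::].
Proof.
by split=> [[|//] [|//]|[]|[|//] [|//]] //; rewrite ht_nil.
Qed.

Lemma climbing_cat c u w : climbing c u -> 0 <= ht c u -> climbing c w ->
  climbing c (u ++ w).
Proof.
move=> cu u0 cw p q /cat_eq_cat [[r -> ew]|[r eu _]]; last exact: cu eu.
case: r ew => [|a r] ew; first by rewrite cats0 => /(cu _ [::]); rewrite cats0; apply.
rewrite ht_cat => _; have : 0 < ht c (a :: r) by apply: cw ew _.
lia.
Qed.

Lemma capped_cat c u w : capped c u -> capped c w -> capped c (u ++ w).
Proof.
move=> cu cw p q /cat_eq_cat [[r _ ew]|[r eu ->]]; first exact: cw ew.
by rewrite ht_cat addr_ge0 ?(cu _ _ eu) ?(cw [::] w).
Qed.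

Lemma saw_cat_ht c u w : saw u -> saw w ->
  (forall p u' w' q, u = p ++ u' -> w = w' ++ q -> u' <> [::] -> w' <> [::] ->
    0 < ht c u' + ht c w') ->
  saw (u ++ w).
Proof.
move=> su sw uw; apply: saw_cat => // p u' w' q eu ew u'0 w'0.
rewrite -disp_cat => /(ht0 c); rewrite ht_cat => h.
by have := uw _ _ _ _ eu ew u'0 w'0; rewrite h ltxx.
Qed.

Lemma saw_cat_climbing c u w : saw u -> saw w -> capped c u -> climbing c w ->
  saw (u ++ w).
Proof.
move=> su sw cu cw; apply: (@saw_cat_ht c) => // p u' w' q eu ew _ w'0.
by rewrite ltr_wpDl ?(cw _ _ ew) ?(cu _ _ eu).
Qed.

Lemma bridge_cat c u w : bridge c u -> bridge c w -> bridge c (u ++ w).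
Proof.
move=> bu bw; have u0 := bridge_ht_ge0 bu; case: bu bw => su lu cu [sw lw cw].
split; [exact: saw_cat_climbing su sw cu lw | exact: climbing_cat | exact: capped_cat].
Qed.

Lemma ht_opp c s : ht (\- c) s = - ht c s.
Proof. by rewrite /ht -sumrN; apply: eq_bigr => i _ /=; rewrite mulrN. Qed.

(* Cuts the walk at its last highest point. *)
Lemma last_max c s :
  exists u v, [/\ s = u ++ v, capped c u & climbing (\- c) v].
Proof.
elim: s => [|a s [u [v [-> cu lv]]]].
  exists [::], [::]; split=> // [p q|[|//] [|//]] //.
  by case: p => [|//]; case: q => [|//]; rewrite ht_nil.
(* The old maximum, seen from the new start, has height [ht c (a :: u)]. If this is nonnegative the
   cut stays there; otherwise the new start is the strict maximum. *)
have [h|h] := leP 0 (ht c (a :: u)).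
  exists (a :: u), v; split=> // -[|b p] q /=; first by move=> <-.
  by case=> _ /cu.
exists [::], (a :: u ++ v); split=> // [[|//] [|//]|[//|_ p] q [<- e _]].
  by rewrite ht_nil.
rewrite ht_opp oppr_gt0; case/cat_eq_cat: e => [[[|b r] -> e]|[r e _]].
- by rewrite cats0.
- have : 0 < ht (\- c) (b :: r) by apply: lv e _.
  by rewrite -cat_cons ht_cat ht_opp; lia.
- by have := cu _ _ e; move: h; rewrite e -cat_cons ht_cat; lia.
Qed.

Lemma ht_prefix_le c u v p q : capped c u -> climbing (\- c) v ->
  u ++ v = p ++ q -> ht c p <= ht c u.
Proof.
move=> cu lv /cat_eq_cat [[[|a r] -> e]|[r e _]].
- by rewrite cats0.
- have : 0 < ht (\- c) (a :: r) by apply: lv e _.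
  by rewrite ht_cat ht_opp; lia.
- by have := cu _ _ e; rewrite e ht_cat; lia.
Qed.

(** * Cutting walks into half-space walks and bridges *)

Definition coord (k : 'I_d) (i : 'I_d) : int := (i == k)%:R.

Lemma ht_coord k s : ht (coord k) s = disp s 0 k.
Proof.
rewrite /ht (bigD1 k) //= big1 => [|i /negPf ik]; rewrite /coord.
  by rewrite eqxx mulr1 addr0.
by rewrite ik mulr0.
Qed.

Lemma ht_refl k s : ht (coord k) (map (refl k) s) = - ht (coord k) s.
Proof. by rewrite !ht_coord disp_refl eqxx mulN1r. Qed.

Definition half c s := saw s /\ climbing c s.

Definition half_le c (A : nat) s :=
  half c s /\ forall p q, s = p ++ q -> ht c p <= A%:Z.

(** If height A + 1 is reached, cut at its last visit. What follows stays strictly below the top and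
    strictly above 0, so its reflection climbs through heights 1 to A only. *)
Lemma half_le_cut k A s : half_le (coord k) A.+1 s ->
  half_le (coord k) A s \/
  exists u v, [/\ s = u ++ v, bridge (coord k) u, ht (coord k) u = A.+1%:Z
    & half_le (coord k) A (map (refl k) v)].
Proof.
move=> [[ss cs] hs]; have [u [v [e cu lv]]] := last_max (coord k) s.
have [uA|Au] := leP (ht (coord k) u) A%:Z.
  left; split=> // p q e'; apply: le_trans uA.
  by apply: (ht_prefix_le (q := q) cu lv); rewrite -e.
have {}Au : ht (coord k) u = A.+1%:Z by have := hs _ _ e; lia.
right; exists u, v; split=> //.
  split=> //; first by rewrite e in ss; apply: saw_catl ss.
  by move=> p q e'; apply: (cs p (q ++ v)); rewrite e e' catA.
split; first split.
- by apply: saw_refl; rewrite e in ss; apply: saw_catr ss.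
- move=> p' q' /map_eq_cat [p [q [e' -> _]]] p0.
  rewrite ht_refl -ht_opp; apply: (lv _ _ e') => p0'; by rewrite p0' in p0.
- move=> p' q' /map_eq_cat [p [q [e' -> _]]].
  rewrite ht_refl.
  have [->|/eqP p0] := eqVneq p [::]; first by rewrite ht_nil; lia.
  have : 0 < ht (coord k) (u ++ p).
    apply: (cs _ q); first by rewrite e e' catA.
    by case: (u).
  by rewrite ht_cat Au; lia.
Qed.

Lemma half_cut c s : saw s -> exists u v,
  [/\ s = u ++ v, half c v & capped (\- c) u].
Proof.
move=> ss; have [u [v [e cu lv]]] := last_max (\- c) s.
exists u, v; split=> //; split; first by rewrite e in ss; apply: saw_catr ss.
by move=> p q e' p0; have := lv _ _ e' p0; rewrite !ht_opp opprK.
Qed.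

(** The prefix ends at a lowest point that may be tied. Reading it backwards after one extra upward
    step makes the inequality strict; this is the source of the length n + 1 below. *)
Lemma half_prefix_rev k u : saw u -> capped (\- (coord k)) u ->
  half (coord k) ((k, false) :: rev (map flip u)).
Proof.
move=> su cu.
have up : ht (coord k) [:: (k, false)] = 1 by rewrite ht_vec /coord /= eqxx.
have h p q : rev (map flip u) = p ++ q -> 0 <= ht (coord k) p.
  move=> /rev_eq_cat /map_eq_cat [p' [q' [e _ eq]]].
  by rewrite -ht_rev eq ht_flip -ht_opp; apply: cu e.
split; last first.
  move=> [//|b p] q [<- e _]; rewrite -cat1s ht_cat up.
  by have := h _ _ e; lia.
rewrite -cat1s; apply: (@saw_cat_ht (coord k)).
- move=> p f q; case: f p => [//|b [|b' f]] [|b'' [|? p]] //= [<- _].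
  by move/(ht0 (coord k)); rewrite up.
- exact/saw_rev/saw_flip.
move=> p u' w' q e e' u0 _.
have -> : u' = [:: (k, false)] by case: p u' e u0 => [|? [|? ?]] [|? [|? ?]] //= [].
by rewrite up; have := h _ _ e'; lia.
Qed.
End Words.

Lemma ler_sum_subseq (R : numDomainType) (T : eqType) (L W : seq T) (f : T -> R) :
  uniq L -> uniq W -> {subset L <= W} -> (forall z, 0 <= f z) ->
  \sum_(z <- L) f z <= \sum_(z <- W) f z.
Proof.
move=> uL uW LW f0.
rewrite (perm_big [seq z <- W | z \in L]) /=; last first.
  apply: uniq_perm => //; first exact: filter_uniq.
  by move=> z; rewrite mem_filter; have [/LW ->|] := boolP (z \in L).
by rewrite big_filter big_mkcond; apply: ler_sum => z _; case: ifP.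
Qed.

(** * Counting words *)

Section Counting.
Variable d : nat.
Local Notation word := (seq ('I_d * bool)).
Implicit Types (P Q S : word -> Prop) (L : seq word) (s u v w : word).

Definition words P n : seq word :=
  [seq s <- map val (enum {: n.-tuple ('I_d * bool)}) | `[< P s >]].

Definition wcount P n := size (words P n).

Lemma wordsP P n s : reflect (size s = n /\ P s) (s \in words P n).
Proof.
rewrite mem_filter; apply: (iffP andP) => [[/asboolP Ps /mapP[t _ e]]|[e Ps]].
  by split=> //; rewrite e size_tuple.
split; first exact/asboolP.
by apply/mapP; exists (Tuple (introT eqP e)); rewrite ?mem_enum.
Qed.

Lemma words_uniq P n : uniq (words P n).
Proof. by rewrite filter_uniq // map_inj_uniq ?enum_uniq //; exact: val_inj. Qed.

Lemma wcount_le P n L : (forall s, size s = n -> P s -> s \in L) ->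
  (wcount P n <= size L)%N.
Proof.
move=> h; apply: uniq_leq_size (words_uniq P n) _ => s /wordsP[e Ps]; exact: h.
Qed.

Lemma wcount_ge P n L : uniq L -> (forall s, s \in L -> size s = n /\ P s) ->
  (size L <= wcount P n)%N.
Proof.
move=> uL h; apply: uniq_leq_size uL _ => s /h; exact: introT (wordsP _ _ _).
Qed.

Lemma words_cat_uniq P Q m n :
  uniq [seq u ++ v | u <- words P m, v <- words Q n].
Proof.
apply: allpairs_uniq; rewrite ?words_uniq //.
move=> p q /allpairsP[[u v] /= [/wordsP[su _] _ ->]].
move=> /allpairsP[[u' v'] /= [/wordsP[su' _] _ ->]] /= /eqP.
by rewrite eqseq_cat ?su // => /andP[/eqP -> /eqP ->].
Qed.

Lemma wcount_cat P Q S m n : (forall u v, P u -> Q v -> S (u ++ v)) ->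
  (wcount P m * wcount Q n <= wcount S (m + n))%N.
Proof.
move=> h; rewrite /wcount -(size_allpairs cat); apply: wcount_ge => [|s].
  exact: words_cat_uniq.
case/allpairsP => -[u v] [/wordsP[/= su Pu] /wordsP[/= sv Qv] ->].
by rewrite size_cat su sv; split=> //; apply: h.
Qed.

Lemma wcount_split P Q S m n : (forall u v, S (u ++ v) -> P u /\ Q v) ->
  (wcount S (m + n) <= wcount P m * wcount Q n)%N.
Proof.
move=> h; rewrite /wcount -(size_allpairs cat); apply: wcount_le => s es Ss.
have [Pu Qv] : P (take m s) /\ Q (drop m s) by apply: h; rewrite cat_take_drop.
apply/allpairsP; exists (take m s, drop m s); split; rewrite ?cat_take_drop //.
  by apply/wordsP; rewrite size_takel // es leq_addr.
by apply/wordsP; rewrite size_drop es addKn.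
Qed.

Lemma wcount_bridge_mul c m n :
  (wcount (bridge c) m * wcount (bridge c) n <= wcount (bridge c) (m + n))%N.
Proof. by apply: wcount_cat => u v; exact: bridge_cat. Qed.

Lemma wcount_saw_mul m n :
  (wcount (@saw d) (m + n) <= wcount (@saw d) m * wcount (@saw d) n)%N.
Proof.
by apply: wcount_split => u v s; split; [exact: saw_catl s | exact: saw_catr s].
Qed.

Lemma size_allpairs_iota (T : Type) (F : nat -> seq T) n :
  size [seq z | i <- iota 0 n, z <- F i] = (\sum_(i < n) size (F i))%N.
Proof.
by rewrite size_allpairs_dep sumnE big_map -(big_mkord xpredT (size \o F)) /index_iota subn0.
Qed.

(** Cut at the last lowest point, after i steps. The first piece gains one step when it is turned
    into a half-space walk, and [behead] removes that step again. *)
Lemma wcount_saw_half (k : 'I_d) n :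
  (wcount (@saw d) n <= \sum_(i < n.+1)
     wcount (half (coord k)) i.+1 * wcount (half (coord k)) (n - i))%N.
Proof.
pose F i := [seq rev (map (@flip d) (behead w)) ++ v | w <- words (half (coord k)) i.+1,
   v <- words (half (coord k)) (n - i)].
under eq_bigr => i _ do
  rewrite /wcount
    -(size_allpairs (fun w v => rev (map (@flip d) (behead w)) ++ v)) -/(F i).
rewrite -(size_allpairs_iota F); apply: wcount_le => s es ss.
have [u [v [e hv cu]]] := half_cut (coord k) ss.
apply/allpairsPdep; exists (size u), s; split=> //.
  by rewrite mem_iota -es e size_cat /=; lia.
apply/allpairsP; exists ((k, false) :: rev (map (@flip d) u), v); split.
- apply/wordsP; rewrite /= size_rev size_map; split=> //.
  by apply: half_prefix_rev => //; rewrite e in ss; apply: saw_catl ss.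
- by apply/wordsP; rewrite -es e size_cat addKn.
- by rewrite /= map_rev mapK ?revK //; exact: flipK.
Qed.

(** * Half-space walks *)

Section HalfSpace.
Variables (k : 'I_d) (R : realType).

Local Notation hk := (ht (coord k)).

Lemma ht_coord_le s : `|hk s| <= (size s)%:Z.
Proof.
elim: s => [|a s IHs]; first by rewrite ht_nil.
rewrite ht_cons [coord k a.1]/coord.
by case: (a.1 == k); case: a.2; rewrite ?mulr0 ?mulr1 ?expr0 ?expr1 /=; lia.
Qed.

(** Generating function of bridges by height. The absolute value only yields a natural exponent,
    since bridges have nonnegative height. *)
Definition bridge_weight (x : R) n : R :=
  \sum_(s <- words (bridge (coord k)) n) x ^- `|hk s|%N.

Definition bridge_of A s := bridge (coord k) s /\ hk s = A%:Z.

(** Prepending a bridge of height A divides the weight by x ^ A. No word arises twice: what follows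
    the first bridge climbs strictly, so the cut is the last visit to height A. *)
Lemma bridge_weight_cat (x : R) A n : 0 < x ->
  \sum_(i < n.+1) (wcount (bridge_of A) i)%:R * bridge_weight x (n - i)
    <= x ^+ A * bridge_weight x n.
Proof.
move=> x0.
pose F i := [seq u ++ v | u <- words (bridge_of A) i,
                          v <- words (bridge (coord k)) (n - i)].
rewrite -ler_pdivrMl ?exprn_gt0 //.
have -> : (x ^+ A)^-1 *
    \sum_(i < n.+1) (wcount (bridge_of A) i)%:R * bridge_weight x (n - i) =
    \sum_(z <- [seq z | i <- iota 0 n.+1, z <- F i]) x ^- `|hk z|%N.
  rewrite big_allpairs_dep -[n.+1 in RHS]subn0 -/(index_iota 0 n.+1) big_mkord mulr_sumr.
  apply: eq_bigr => i _; rewrite big_allpairs_dep /=.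
  rewrite /wcount -sum1_size natr_sum mulr_suml mulr_sumr.
  apply: eq_big_seq => u /wordsP[_ [_ hu]].
  rewrite mul1r mulr_sumr; apply: eq_big_seq => v /wordsP[_ /bridge_ht_ge0 hv].
  have -> : `|hk (u ++ v)|%N = (A + `|hk v|)%N by rewrite ht_cat; lia.
  by rewrite exprD invfM.
apply: ler_sum_subseq.
- apply: allpairs_uniq_dep; first exact: iota_uniq.
    by move=> i _; exact: words_cat_uniq.
  move=> p q /allpairsPdep[i [z [_ zi ->]]] /allpairsPdep[j [z' [_ zj ->]]] /= e.
  suff ij : i = j by rewrite ij e.
  move: zi zj; rewrite -e.
  case/allpairsP => -[u v] [/wordsP[/= su [bu hu]] /wordsP[/= _ [_ lv _]] ez].
  case/allpairsP => -[u' v'] [/wordsP[/= su' [bu' hu']] /wordsP[/= _ [_ lv' _]]].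
  rewrite ez -su -su' => /cat_eq_cat[[[|a r] eu ev]|[[|a r] eu ev]].
  + by rewrite eu cats0.
  + have : 0 < hk (a :: r) by apply: lv ev _.
    by move: hu'; rewrite eu ht_cat; lia.
  + by rewrite eu cats0.
  + have : 0 < hk (a :: r) by apply: lv' ev _.
    by move: hu; rewrite eu ht_cat; lia.
- exact: words_uniq.
- move=> z /allpairsPdep[i [_ [+ /allpairsP[[u v] [+ + ->]] ->]]] /=.
  move=> + /wordsP[/= su [bu _]] /wordsP[/= sv bv].
  rewrite mem_iota => /= i_lt; apply/wordsP; rewrite size_cat su sv; split; first lia.
  exact: bridge_cat.
- by move=> z; rewrite invr_ge0 exprn_ge0 // ltW.
Qed.

Lemma wcount_half_le_step A n :
  (wcount (half_le (coord k) A.+1) n <= wcount (half_le (coord k) A) n +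
     \sum_(i < n.+1)
       wcount (bridge_of A.+1) i * wcount (half_le (coord k) A) (n - i))%N.
Proof.
pose F i := [seq u ++ map (refl k) v | u <- words (bridge_of A.+1) i,
                          v <- words (half_le (coord k) A) (n - i)].
have -> : (\sum_(i < n.+1)
    wcount (bridge_of A.+1) i * wcount (half_le (coord k) A) (n - i) =
   \sum_(i < n.+1) size (F i))%N.
  by apply: eq_bigr => i _; rewrite size_allpairs.
rewrite -(size_allpairs_iota F) /wcount -size_cat; apply: wcount_le => s es.
rewrite mem_cat => /half_le_cut[h|[u [v [e bu hu hv]]]]; apply/orP.
  by left; apply/wordsP.
right; apply/allpairsPdep; exists (size u), s; split=> //.
  by rewrite mem_iota /= -es e size_cat; lia.
apply/allpairsP; exists (u, map (refl k) v); split; last first.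
- by rewrite /= mapK //; exact: reflK.
- by apply/wordsP; rewrite size_map -es e size_cat addKn.
- exact/wordsP.
Qed.

Lemma bridge_weight_ge0 (x : R) n : 0 < x -> 0 <= bridge_weight x n.
Proof. by move=> x0; apply: sumr_ge0 => s _; rewrite invr_ge0 exprn_ge0 // ltW. Qed.

(** Induction on A. A piece of height A + 1 is either absent or cut off once, and absorbing it into
    the weight costs x ^ (A + 1), whence the factor 1 + x ^ (A + 1). *)
Lemma wcount_half_le (x : R) A n : 0 < x ->
  (wcount (half_le (coord k) A) n)%:R
    <= (\prod_(i < A) (1 + x ^+ i.+1)) * bridge_weight x n.
Proof.
move=> x0; elim: A n => [|A IHA] n.
  (* Height at most 0 leaves only the empty word, which is a bridge of weight 1. *)
  rewrite big_ord0 mul1r; have nil_only s : half_le (coord k) 0 s -> s = [::].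
    case=> -[_ ls] hs; case: s ls hs => // a s ls hs.
    have : 0 < hk (a :: s) by apply: (ls _ [::]); rewrite ?cats0.
    by have := hs _ [::] (esym (cats0 _)); lia.
  case: n => [|n]; last first.
    rewrite (_ : wcount _ _ = 0%N) ?bridge_weight_ge0 //; apply/eqP.
    rewrite -leqn0; apply: (wcount_le (L := [::])) => s es /nil_only e.
    by rewrite e in es.
  apply: (@le_trans _ _ 1).
    by rewrite lern1; apply: (wcount_le (L := [:: [::]])) => s es /nil_only ->.
  have := @ler_sum_subseq R _ [:: [::]] (words (bridge (coord k)) 0)
    (fun s => x ^- `|hk s|%N).
  rewrite big_seq1 ht_nil expr0 invr1; apply=> //; first exact: words_uniq.
    by move=> s; rewrite inE => /eqP ->; apply/wordsP; split=> //; exact: bridge_nil.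
  by move=> z; rewrite invr_ge0 exprn_ge0 // ltW.
rewrite big_ord_recr /= mulrDr mulr1 mulrDl.
apply: le_trans (_ : (wcount (half_le (coord k) A) n +
     \sum_(i < n.+1)
       wcount (bridge_of A.+1) i * wcount (half_le (coord k) A) (n - i))%:R <= _).
  by rewrite ler_nat wcount_half_le_step.
rewrite natrD lerD // -mulrA.
have P0 : 0 <= \prod_(i < A) (1 + x ^+ i.+1).
  by apply: prodr_ge0 => i _; rewrite addr_ge0 // exprn_ge0 // ltW.
apply: le_trans (ler_wpM2l P0 (bridge_weight_cat A.+1 n x0)).
rewrite natr_sum mulr_sumr; apply: ler_sum => i _.
by rewrite natrM mulrCA ler_wpM2l.
Qed.

Lemma wcount_half (n j : nat) : (0 < n)%N -> (j <= n)%N ->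
  (wcount (half (coord k)) j)%:R
    <= expR (2 * Num.sqrt n%:R) * (wcount (bridge (coord k)) j)%:R :> R.
Proof.
move=> n0 jn; set r := Num.sqrt _.
have r0 : 0 < r by rewrite sqrtr_gt0 ltr0n.
have rr : r * r = n%:R by rewrite -expr2 sqr_sqrtr.
pose x := r / (r + 1).
have r1 : r + 1 != 0 by rewrite gt_eqF // addr_gt0.
have x0 : 0 < x by rewrite divr_gt0 // addr_gt0.
have xr : x * (r + 1) = r by rewrite divfK.
have x1 : x <= 1 by rewrite ler_pdivrMr ?addr_gt0 // mul1r lerDl.
apply: le_trans (_ : (wcount (half_le (coord k) j) j)%:R <= _).
  rewrite ler_nat; apply: wcount_le => s es hs; apply/wordsP; split=> //; split=> // p q e.
  have := ht_coord_le p; suff : (size p <= j)%N by lia.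
  by rewrite -es e size_cat leq_addr.
apply: le_trans (wcount_half_le j j x0) _.
have -> : 2 * r = r + r by rewrite mulr2n mulrDl mul1r.
rewrite expRD -mulrA; apply: ler_pM.
- by apply: prodr_ge0 => i _; rewrite addr_ge0 // exprn_ge0 // ltW.
- exact: bridge_weight_ge0.
(* As x (r + 1) = r, the geometric sum x + ... + x ^ j equals r (1 - x ^ j); combine this with 1 + y
   <= exp y. *)
- have : \prod_(i < j) (1 + x ^+ i.+1) <= expR (r * (1 - x ^+ j)).
    elim: (j) => [|m IHm]; first by rewrite big_ord0 expr0 subrr mulr0 expR0.
    have -> : r * (1 - x ^+ m.+1) = r * (1 - x ^+ m) + x ^+ m.+1.
      apply/eqP; rewrite exprS -subr_eq0.
      have -> : r * (1 - x * x ^+ m) - (r * (1 - x ^+ m) + x * x ^+ m) =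
        x ^+ m * (r - x * (r + 1)) by ring.
      by rewrite xr subrr mulr0.
    rewrite big_ord_recr /= expRD ler_pM ?expR_ge1Dx //.
      by apply: prodr_ge0 => i _; rewrite addr_ge0 // exprn_ge0 // ltW.
    by rewrite addr_ge0 // exprn_ge0 // ltW.
  move/le_trans; apply; rewrite ler_expR ler_piMr ?ltW //.
  by rewrite gtrBl exprn_gt0.
(* Here 1 / x = 1 + 1 / r <= exp (1 / r), and a height is at most j <= n = r * r, so each weight is
   at most exp r. *)
- rewrite /wcount -sum1_size natr_sum mulr_sumr.
  rewrite /bridge_weight big_seq [leRHS]big_seq; apply: ler_sum => s /wordsP[es _].
  rewrite mulr1 -exprVn.
  have -> : x^-1 = 1 + r^-1.
    by rewrite /x invf_div mulrDl divff ?gt_eqF // mul1r.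
  apply: (@le_trans _ _ (expR r^-1 ^+ `|hk s|%N)).
    by rewrite lerXn2r ?nnegrE ?expR_ge0 ?expR_ge1Dx // addr_ge0 // invr_ge0 ltW.
  rewrite -expRM_natl ler_expR ler_pdivrMr // rr ler_nat.
  by have := ht_coord_le s; lia.
Qed.
End HalfSpace.
End Counting.

(** * From self-avoiding walks to bridges *)

Section Saw_bridge.
Variables (d : nat) (R : realType).

(** Each of the two half-space pieces costs exp (2 sqrt (n + 1)). The two resulting bridges
    concatenate to one of length (i + 1) + (n - i) = n + 1, and there are n + 1 cuts. *)
Lemma wcount_saw_le_bridge (k : 'I_d) n : (wcount (@saw d) n)%:R <=
  (n.+1)%:R * expR (4 * Num.sqrt n.+1%:R) * (wcount (bridge (coord k)) n.+1)%:R :> R.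
Proof.
apply: le_trans (_ : (\sum_(i < n.+1) wcount (half (coord k)) i.+1 *
   wcount (half (coord k)) (n - i))%:R <= _).
  by rewrite ler_nat wcount_saw_half.
rewrite natr_sum.
apply: le_trans (_ : \sum_(i < n.+1) expR (4 * Num.sqrt n.+1%:R) *
    (wcount (bridge (coord k)) n.+1)%:R <= _); last first.
  by rewrite sumr_const card_ord -[leLHS]mulr_natl mulrA.
apply: ler_sum => i _; have i_lt := ltn_ord i; rewrite natrM.
apply: le_trans (ler_pM _ _ (wcount_half k R (ltn0Sn n) _)
   (wcount_half k R (ltn0Sn n) _)) _ => //; first lia.
rewrite mulrACA -expRD -mulrDl -natrD -natrM ler_wpM2l ?expR_ge0 // ler_nat.
have := wcount_bridge_mul (coord k) i.+1 (n - i).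
by rewrite (_ : i.+1 + (n - i) = n.+1)%N //; lia.
Qed.
End Saw_bridge.

(** * Polygons *)

Section Polygons.
Variable d : nat.
Local Notation word := (seq ('I_d * bool)).
Implicit Types (c : 'I_d -> int) (s t u v w p q : word) (x : 'rV[int]_d).

Lemma disp_count s : disp s = \sum_a vec a *+ count_mem a s.
Proof.
elim: s => [|b s IHs].
  by rewrite disp_nil big1 // => a _; rewrite mulr0n.
rewrite disp_cons IHs; under [RHS]eq_bigr => a _ do rewrite /= mulrnDr.
rewrite big_split /=; congr (_ + _).
rewrite (bigD1 b) //= eqxx mulr1n big1 ?addr0 // => a /negPf ab.
by rewrite eq_sym ab mulr0n.
Qed.

Definition ends_at x (P : word -> Prop) s := P s /\ disp s = x.

(** The displacement depends only on how often each of the 2 d letters occurs, and each multiplicity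
    lies between 0 and n. The most frequent vector of multiplicities gives x. *)
Lemma wcount_pigeonhole P n : exists x,
  (wcount P n <= n.+1 ^ (d * 2) * wcount (ends_at x P) n)%N.
Proof.
pose F s : {ffun ('I_d * bool) -> 'I_n.+1} := [ffun a => inord (count_mem a s)].
pose N f := count (fun s => F s == f) (words P n).
have f0 : {ffun ('I_d * bool) -> 'I_n.+1} := [ffun=> ord0].
case: (arg_maxnP N (isT : xpredT f0)) => f _ fmax.
exists (\sum_a vec a *+ f a).
have -> : (n.+1 ^ (d * 2) = #|{: {ffun ('I_d * bool) -> 'I_n.+1}}|)%N.
  by rewrite card_ffun card_prod card_bool !card_ord.
apply: (@leq_trans (\sum_g N g)%N).
  rewrite /N /wcount; under eq_bigr => g _ do rewrite -sum1_count big_mkcond.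
  rewrite exchange_big /= -sum1_size; apply: leq_sum => s _.
  by rewrite (bigD1 (F s)) //= eqxx leq_addr.
rewrite -sum_nat_const; apply: leq_sum => g _.
apply: leq_trans (fmax g isT) _; rewrite /N -size_filter.
apply: wcount_ge; first by rewrite filter_uniq ?words_uniq.
move=> s; rewrite mem_filter => /andP[/eqP sf /wordsP[es Ps]]; split=> //.
split=> //; rewrite disp_count -sf; apply: eq_bigr => a _.
by rewrite ffunE inordK // ltnS -es count_size.
Qed.

Definition above c s := forall p q, s = p ++ q -> 0 <= ht c p.

(* Cutting at a lowest point for [c] and swapping the two pieces keeps the walk
   self-avoiding because the pieces of a bridge only meet at their junction. *)
Lemma bridge_rot c (k : 'I_d) s : bridge (coord k) s -> ht c s = 0 ->
  exists u v, [/\ s = u ++ v, saw (v ++ u) & above c (v ++ u)].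
Proof.
move=> [ss ls cs] s0; have [u [v [e cu lv]]] := last_max (\- c) s.
subst s; exists u, v; split=> //.
  apply: (@saw_cat_climbing _ (coord k)).
  - exact: saw_catr ss.
  - exact: saw_catl ss.
  - by move=> p q e'; apply: (cs (u ++ p)); rewrite e' catA.
  - by move=> p q e'; apply: (ls _ (q ++ v)); rewrite e' catA.
have hv p q : v = p ++ q -> 0 <= ht c p.
  case: p => [|a p] e; first by rewrite ht_nil.
  have : 0 < ht (\- \- c) (a :: p) by apply: lv e _.
  by rewrite !ht_opp opprK => /ltW.
move=> p q /cat_eq_cat[[r -> e]|[r e _]]; last exact: hv e.
have := cu _ _ e; rewrite ht_opp e !ht_cat in s0 *; lia.
Qed.

(** A functional that vanishes at x, so that a walk to x has both ends at height 0, and that gives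
    the step e_k0 the height [x 0 k1], positive in the application. *)
Definition perp (k0 k1 : 'I_d) x : 'I_d -> int :=
  fun i => x 0 k1 * coord k0 i - x 0 k0 * coord k1 i.

Lemma ht_perp k0 k1 x s :
  ht (perp k0 k1 x) s = x 0 k1 * disp s 0 k0 - x 0 k0 * disp s 0 k1.
Proof.
rewrite -!ht_coord /ht !mulr_sumr -sumrB; apply: eq_bigr => i _.
by rewrite /perp; ring.
Qed.

(** Rotation forgets only the place of the cut, one of n + 1; [rotr] undoes it. *)
Lemma wcount_bridge_above k0 k1 x n :
  (wcount (ends_at x (bridge (coord k1))) n <=
     n.+1 * wcount (ends_at x (fun s => saw s /\ above (perp k0 k1 x) s)) n)%N.
Proof.
set P := ends_at _ (fun s => _).
rewrite -[X in (X * _)%N](size_iota 0) /wcount -(size_allpairs (fun i t => rotr i t)).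
apply: wcount_le => s es [bs xs].
have [|u [v [e sr ar]]] := @bridge_rot (perp k0 k1 x) k1 s bs.
  by rewrite ht_perp xs; lia.
apply/allpairsP; exists (size u, v ++ u); split.
- by rewrite mem_iota -es e size_cat /=; lia.
- apply/wordsP; rewrite size_cat addnC -size_cat -e; split=> //; split=> //.
  by rewrite disp_cat addrC -disp_cat -e.
- by rewrite -rot_size_cat rotK.
Qed.

Lemma saw_cons_ht c a s : saw s ->
  (forall p q, s = p ++ q -> 0 < ht c (a :: p)) -> saw (a :: s).
Proof.
move=> ss h; rewrite -cat1s; apply: (@saw_cat_ht _ c) => //.
  move=> p u q; case: u p => [//|b [|b' u]] [|b'' [|? p]] //= [<- _].
  by move/(ht0 c) => a0; have := h [::] s erefl; rewrite a0.
move=> p u w q e /h hw u0 _.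
have -> : u = [:: a] by case: p u e u0 => [|? [|? ?]] [|? [|? ?]] //= [].
by rewrite -ht_cat.
Qed.

(* The first walk lies below a hyperplane through 0 and x, the second one
   strictly above it once translated by e_k0. *)
Lemma saw_close k0 k1 x t t' : k0 != k1 -> 0 < x 0 k1 ->
  saw t -> above (perp k0 k1 x) t -> disp t = x ->
  saw t' -> above (perp k0 k1 x) t' -> disp t' = x ->
  saw (rev t ++ (k0, false) :: rev (map (@flip d) t')).
Proof.
move=> k01 x0 st at0 xt st' at' xt'; set c := perp k0 k1 x.
have h0 s : disp s = x -> ht c s = 0 by rewrite ht_perp => ->; lia.
(* The total height of [t'] is 0, so a point of the reversed second walk is as high above the tip of
   e_k0 as a prefix of [t'] is above 0. *)
have up p q : rev (map (@flip d) t') = p ++ q -> 0 < ht c ((k0, false) :: p).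
  move=> /rev_eq_cat /map_eq_cat [p' [q' [e _ eq]]].
  have -> : ht c ((k0, false) :: p) = x 0 k1 + ht c p.
    rewrite ht_cons /c /perp /coord eqxx (negPf k01) /=.
    by rewrite expr0 mul1r mulr1 mulr0 subr0.
  rewrite -(ht_rev _ p) eq ht_flip.
  by have := at' _ _ e; have := h0 _ xt'; rewrite e ht_cat -/c; lia.
apply: (@saw_cat_ht _ c).
- exact: saw_rev.
- by apply: (@saw_cons_ht c) up; exact/saw_rev/saw_flip.
move=> p u w q /rev_eq_cat e ew _ w0; rewrite -(ht_rev _ u).
have := at0 _ _ e; case: w ew w0 => [//|b w] [<- /up].
by move=> w0 _ u0; rewrite ltr_wpDl.
Qed.

Lemma wcount_above_sq k0 k1 x n : k0 != k1 -> 0 < x 0 k1 ->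
  (wcount (ends_at x (fun s => saw s /\ above (perp k0 k1 x) s)) n ^ 2 <=
     wcount (ends_at (vec (k0, false)) (@saw d)) (2 * n + 1))%N.
Proof.
move=> k01 x0; set P := ends_at _ (fun s => _).
pose f t t' := rev t ++ (k0, false) :: rev (map (@flip d) t').
rewrite -mulnn -(size_allpairs f); apply: wcount_ge.
  apply: allpairs_uniq; rewrite ?words_uniq //.
  move=> y z /allpairsP[[u v] /= [/wordsP[su _] /wordsP[sv _] ->]].
  move=> /allpairsP[[u' v'] /= [/wordsP[su' _] /wordsP[sv' _] ->]] /= /eqP.
  rewrite eqseq_cat ?size_rev ?su // eqseq_cons => /and3P[/eqP eu _ /eqP ev].
  by rewrite (can_inj revK eu) (inj_map (can_inj (@flipK d)) (can_inj revK ev)).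
move=> z /allpairsP[[t t'] /= [/wordsP[st [[? ?] xt]] /wordsP[st' [[? ?] xt']] ->]].
rewrite /f size_cat /= !size_rev size_map st st'; split; first lia.
split; first exact: saw_close k01 x0 _ _ xt _ _ xt'.
by rewrite disp_cat disp_cons !disp_rev disp_flip xt xt' addrCA subrr addr0.
Qed.

Lemma bridge_disp_gt0 k s : bridge (coord k) s -> s <> [::] -> 0 < disp s 0 k.
Proof. by case=> _ ls _ s0; rewrite -ht_coord; apply: (ls s [::]); rewrite ?cats0. Qed.

(** Fixing the endpoint costs (n + 1) ^ (2 d) and rotating costs n + 1; squaring gives the exponent
    4 d + 2. A nonempty bridge to x supplies the positivity of [x 0 k1]. *)
Lemma wcount_bridge_sq k0 k1 n : k0 != k1 -> (0 < n)%N ->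
  (wcount (bridge (coord k1)) n ^ 2 <=
     n.+1 ^ (4 * d + 2) * wcount (ends_at (vec (k0, false)) (@saw d)) (2 * n + 1))%N.
Proof.
move=> k01 n0; have [x hx] := wcount_pigeonhole (bridge (coord k1)) n.
have [b0|] := posnP (wcount (ends_at x (bridge (coord k1))) n).
  by rewrite b0 muln0 leqn0 in hx; rewrite (eqP hx).
rewrite /wcount; case ew: (words _ n) => [//|s ws] _.
have /wordsP[es [bs xs]] : s \in words (ends_at x (bridge (coord k1))) n.
  by rewrite ew mem_head.
have x0 : 0 < x 0 k1.
  by rewrite -xs; apply: bridge_disp_gt0 => // s0; rewrite -es s0 in n0.
apply: leq_trans (_ : (n.+1 ^ (d * 2) * (n.+1 *
  wcount (ends_at x (fun s => saw s /\ above (perp k0 k1 x) s)) n)) ^ 2 <= _)%N.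
  by rewrite leq_exp2r // (leq_trans hx) // leq_mul2l wcount_bridge_above orbT.
rewrite mulnA -expnSr expnMn -expnM leq_mul ?wcount_above_sq //.
by rewrite leq_exp2l //; lia.
Qed.

(** * Returns and their decomposition into bridges *)

Definition return_word s := disp s = 0 /\ forall p u q, s = p ++ u ++ q ->
  disp u = 0 -> u = [::] \/ p = [::] /\ q = [::].

Lemma return_rcons t a : saw t -> disp t + vec a = 0 -> return_word (rcons t a).
Proof.
move=> st ta; split; first by rewrite -cats1 disp_cat disp_cons disp_nil addr0.
move=> p u q; case: (lastP q) => [|q' b]; last first.
  by rewrite -!rcons_cat => /rcons_inj[e _] u0; left; apply: st e u0.
case: (lastP u) => [|u' b]; first by left.
rewrite cats0 -rcons_cat => /rcons_inj[e <-].
rewrite -cats1 disp_cat disp_cons disp_nil addr0 => u0; right; split=> //.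
apply: (st [::] p u') => //; move: ta u0; rewrite e disp_cat -addrA.
by move=> + u0; rewrite u0 addr0.
Qed.

(** A walk to [vec a] closes with the letter [flip a], its opposite with [a]. The last letter tells
    the two families apart. *)
Lemma wcount_saw_le_return a m :
  (2 * wcount (ends_at (vec a) (@saw d)) m <= wcount return_word m.+1)%N.
Proof.
pose f (b : bool) t := if b then rcons t (flip a) else rcons (map (@flip d) t) a.
rewrite (_ : 2%N = size [:: true; false]) // -(size_allpairs f); apply: wcount_ge.
  apply: allpairs_uniq; rewrite ?words_uniq //.
  move=> y z /allpairsP[[b u] [_ _ ->]] /allpairsP[[b' u'] [_ _ ->]] /=.
  case: b b' => -[] /rcons_inj[].
  - by move=> ->.
  - by move=> _ /eqP; rewrite (negPf (flipP a)).
  - by move=> _ /esym/eqP; rewrite (negPf (flipP a)).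
  - by move=> /(inj_map (can_inj (@flipK d))) ->.
move=> z /allpairsP[[b t] [_ /= /wordsP[<- [st xt]] ->]].
case: b; rewrite /= size_rcons ?size_map; split=> //; apply: return_rcons.
- exact: st.
- by rewrite xt vec_flip subrr.
- exact: saw_flip.
- by rewrite disp_flip xt addNr.
Qed.

(** A closed factor across the new junction has a complement that is a factor of the original word,
    and it is closed because the total displacement is 0. *)
Lemma return_rot u v : return_word (u ++ v) -> return_word (v ++ u).
Proof.
move=> [s0 su]; split; first by rewrite disp_cat addrC -disp_cat.
have nil_cat w w' : w ++ w' = [::] -> w = [::] /\ w' = [::] by case: w w' => [|? ?] [|? ?].
move=> p f q /cat_eq_cat[[r -> e]|[r e1 /cat_eq_cat[[r' e2 ->]|[r' -> e2]]]] f0.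
- have [|->|[-> /nil_cat[-> ->]]] := su r f (q ++ v) _ f0; last 2 first.
  + by left.
  + by right.
  by rewrite e -!catA.
- have [|->|[/nil_cat[-> ->] ->]] := su (u ++ p) f r' _ f0; last 2 first.
  + by left.
  + by right.
  by rewrite e1 e2 -!catA.
have [||/nil_cat[-> ->]|[-> ->]] := su r' (q ++ p) r; last 2 first.
- by right.
- by left.
- by rewrite e1 e2 -!catA.
move: s0 f0; rewrite e1 e2 !disp_cat => s0 f0.
by move: s0; rewrite addrC -addrA [_ + (_ + disp q)]addrA f0 add0r addrC.
Qed.

(* Rooted at a lowest point and cut at a highest one, a return is a pair of
   bridges with the same endpoints; the second one is the reversed second arc. *)
Lemma return_bridges c s : return_word s -> (1 < size s)%N ->
  (forall f, (size f <= size s)%N -> ht c f = 0 -> disp f = 0) ->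
  exists u v a b, [/\ s = u ++ v, v ++ u = a ++ b, disp a + disp b = 0,
    bridge c a & bridge c (rev (map (@flip d) b))].
Proof.
move=> rs s1 sep; have [u [v [e cu lv]]] := last_max (\- c) s.
have rt : return_word (v ++ u) by apply: return_rot; rewrite -e.
have et : size (v ++ u) = size s by rewrite e !size_cat addnC.
have [a [b [e' ca lb]]] := last_max c (v ++ u).
exists u, v, a, b; move: rt; rewrite e' => -[t0 rt].
have tab : disp a + disp b = 0 by rewrite -disp_cat.
have htab : ht c a + ht c b = 0 by rewrite -ht_cat ht0.
have sz p q r : a ++ b = p ++ q ++ r -> (size q <= size s)%N.
  by rewrite -et e' => ->; rewrite !size_cat; lia.
have pre p q : a ++ b = p ++ q -> 0 <= ht c p.
  rewrite -e' => /cat_eq_cat[[r -> er]|[[|x r] er _]]; last first.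
  + case: p er => [|y p] er; first by rewrite ht_nil.
    have : 0 < ht (\- \- c) (y :: p) by apply: lv er _.
    by rewrite !ht_opp opprK => /ltW.
  + rewrite cats0 in er; rewrite -er; case: (v) lv => [|y v'] lv'; first by rewrite ht_nil.
    have : 0 < ht (\- \- c) (y :: v') by apply: (lv' _ [::]); rewrite ?cats0.
    by rewrite !ht_opp opprK => /ltW.
  have := cu _ _ er; have := ht0 c rs.1; rewrite e er !ht_cat ht_opp; lia.
have a0 : a <> [::].
  move=> a0; rewrite a0 /= in e' htab; move: lb htab.
  case: b e' tab {rt pre sz t0} => [|y b] e' _.
    by rewrite e' in et; rewrite -et in s1.
  move=> /(_ (y :: b) [::]); rewrite cats0 ht_opp => /(_ erefl) h.
  by rewrite ht_nil add0r => h'; rewrite h' in h; have := h ltac:(by []).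
(* The root is a lowest point; it is the only one, since a second point at height 0 would coincide
   with it by [sep]. *)
have suf p q : a ++ b = p ++ q -> p <> [::] -> q <> [::] -> 0 < ht c p.
  move=> epq p0 q0; rewrite lt_neqAle eq_sym (pre _ _ epq) andbT.
  apply/eqP => hp; have [||//|[_ //]] := rt [::] p q; first exact: epq.
  by apply: sep hp; apply: (sz [::] _ q).
have b0 : b <> [::].
  move=> b0; rewrite b0 cats0 in e' htab suf; rewrite ht_nil addr0 in htab.
  move: e' ca htab suf; case: (a) => [|x [|y a']] ea ca' h suf'.
  - by rewrite ea in et; rewrite -et in s1.
  - by rewrite ea in et; rewrite -et in s1.
  have := suf' [:: x] (y :: a') erefl ltac:(by []) ltac:(by []).
  by have := ca' [:: x] (y :: a') erefl; rewrite -cat1s ht_cat in h; lia.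
have sb : saw b.
  move=> p q r eb q0; have [|//|[]] := rt (a ++ p) q r _ q0; first by rewrite eb -catA.
  by case: (a) a0.
have sa : saw a.
  move=> p q r ea q0; have [|//|[_]] := rt p q (r ++ b) _ q0; first by rewrite ea -!catA.
  by case: r ea b0 => //= _ + eb; rewrite eb.
split=> //; split=> //.
- move=> p q ea p0; case: q ea => [|y q] ea; first by apply: (suf _ b) => //; rewrite ea cats0.
  by apply: (suf _ (y :: q ++ b)) => //; rewrite ea -catA.
- exact/saw_rev/saw_flip.
- move=> p' q' /rev_eq_cat/map_eq_cat[p [q [eb _ eq]]] p0.
  have q0 : q <> [::] by move=> q0; rewrite q0 /= in eq; apply: p0; rewrite -(revK p') eq.
  rewrite -ht_rev eq ht_flip; have : 0 < ht c (a ++ p).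
    by apply: (suf _ q) => //; [rewrite eb catA | case: (a) a0].
  by move: htab; rewrite eb !ht_cat; lia.
- move=> p' q' /rev_eq_cat/map_eq_cat[p [q [eb ep _]]].
  rewrite -ht_rev ep ht_flip -ht_opp; case: p eb ep => [|y p] eb _; first by rewrite ht_nil.
  by apply/ltW; apply: lb eb _.
Qed.

(** Inverse of gluing two bridges with equal displacement: it looks for the site halfway along the
    total displacement and turns the second arc back. *)
Definition swap_arc z := let j := find (fun j => disp (take j z) == disp (drop j z))
  (iota 0 (size z).+1) in take j z ++ rev (map (@flip d) (drop j z)).

Lemma swap_arcE a b : saw (a ++ b) -> disp a = disp b ->
  swap_arc (a ++ b) = a ++ rev (map (@flip d) b).
Proof.
(* Two halving cuts differ by a factor whose doubled displacement is 0, so the factor is closed and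
   hence empty. *)
have cancel (x y z : int) : x = y + z -> x + y = z -> y = 0 by lia.
move=> sab eab; rewrite /swap_arc.
set P := fun j => _; set j := find _ _.
have hasP : has P (iota 0 (size (a ++ b)).+1).
  apply/hasP; exists (size a); first by rewrite mem_iota size_cat /=; lia.
  by rewrite /P take_size_cat // drop_size_cat // eab.
have j_lt : (j < (size (a ++ b)).+1)%N.
  by move: hasP; rewrite has_find size_iota.
have := nth_find 0%N hasP; rewrite -/j nth_iota // add0n /P.
move: (cat_take_drop j (a ++ b)); move: (take _ _) (drop _ _) => p q epq /eqP hpq.
suff [-> ->] : p = a /\ q = b by [].
case/cat_eq_cat: epq => [[r ea eq]|[r ep eb]]; subst.
  suff r0 : r = [::] by rewrite r0 cats0.
  apply: (sab p r b); first by rewrite -catA.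
  apply/rowP => i; move: hpq eab; rewrite !disp_cat => /rowP/(_ i) + /rowP/(_ i).
  by rewrite !mxE; exact: cancel.
suff r0 : r = [::] by rewrite r0 cats0.
apply: (sab a r q) => //.
apply/rowP => i; move: hpq eab; rewrite !disp_cat => /rowP/(_ i) + /rowP/(_ i).
by rewrite !mxE => h1 h2; exact: cancel h2 h1.
Qed.

Lemma wcount_return_le_bridge c m : (1 < m)%N ->
  (forall f, (size f <= m)%N -> ht c f = 0 -> disp f = 0) ->
  (wcount return_word m <= m * wcount (bridge c) m)%N.
Proof.
move=> m1 sep.
rewrite -[X in (X * _)%N](size_iota 0) /wcount.
rewrite -(size_allpairs (fun i z => rotr i (swap_arc z))).
apply: wcount_le => s es rs.
have [||u [v [a [b [e e' ab0 ba bb]]]]] := @return_bridges c s rs; rewrite ?es //.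
have bab := bridge_cat ba bb.
(* An empty [v] would mean rotation by m, which equals rotation by 0; hence m root positions suffice
   instead of m + 1. *)
apply/allpairsP; exists (if v == [::] then 0%N else size u, a ++ rev (map (@flip d) b)).
split; last 2 first.
- apply/wordsP; split=> //; rewrite /= size_cat size_rev size_map -size_cat -e'.
  by rewrite size_cat addnC -size_cat -e.
- rewrite /= swap_arcE ?map_rev ?revK ?(mapK (@flipK d)) -?e'; last 2 first.
  + by case: bab.
  + by rewrite disp_rev disp_flip; apply/eqP; rewrite -addr_eq0 ab0.
  rewrite e; case: (eqVneq v [::]) => [->|_]; first by rewrite cats0 /rotr subn0 rot_size.
  by rewrite -[v ++ u]rot_size_cat rotK.
rewrite mem_iota /=; case: (eqVneq v [::]) => [_|]; first lia.
by move: es; rewrite e size_cat; case: (v) => //= *; lia.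
Qed.

Lemma disp_le s i : `|disp s 0 i| <= (size s)%:Z.
Proof. by rewrite -ht_coord ht_coord_le. Qed.

(* Reading displacements in base m + 1. *)
Lemma separating_functional m :
  exists c, forall f, (size f <= m)%N -> ht c f = 0 -> disp f = 0.
Proof.
exists (fun i => m.+1%:Z ^+ i) => f fm f0; apply/rowP => i; rewrite mxE.
have [n] := ubnP i; elim: n i => // n IHn i i_lt.
have xi : `|disp f 0 i| <= m%:Z by apply: le_trans (disp_le f i) _.
(* Coordinates before i vanish by induction and later ones carry higher powers of the base, so the
   base m + 1 divides coordinate i, whose absolute value is at most m. *)
suff : (m.+1%:Z %| (disp f 0 i)%R)%Z.
  case/dvdzP => y ey; have [y0|y0] := eqVneq y 0; first by rewrite ey y0 mul0r.
  have y1 : 1 <= `|y| by lia.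
  by move: xi; rewrite ey normrM; nia.
rewrite -(@dvdz_mul2r (m.+1%:Z ^+ i)) ?expf_neq0 // -exprS.
have -> : disp f 0 i * m.+1%:Z ^+ i = - \sum_(j | j != i) disp f 0 j * m.+1%:Z ^+ j.
  by apply/eqP; rewrite -addr_eq0; move: f0; rewrite /ht (bigD1 i) //= => ->.
rewrite rpredN; apply: rpred_sum => j ji.
have [ji'|ij] := leqP j i; last by rewrite dvdz_mull // dvdz_exp2l.
have ji2 : (j < i)%N by rewrite ltn_neqAle ji' andbT; exact: ji.
by rewrite IHn ?mul0r ?dvdz0 // (leq_trans ji2).
Qed.
End Polygons.

Lemma fset_set_seq (T : choiceType) (s : seq T) :
  fset_set [set` s]%classic = [fset x in s]%fset.
Proof.
rewrite -[RHS]set_fsetK; congr fset_set.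
by apply/seteqP; split=> x /=; rewrite !inE.
Qed.

(** * Lattice paths *)

Section Paths.
Variable d : nat.
Local Notation word := (seq ('I_d * bool)).
Implicit Types (s p q u v : word).

Definition path_of_word n s : path_of d n := [ffun i : 'I_n.+1 => disp (take i s)].

Lemma vec_inj : injective (@vec d).
Proof.
move=> [i b] [j b'] /rowP e; have := e i; rewrite /vec !mxE !eqxx /= mulr1.
case: (i =P j) => [->|_]; last by rewrite mulr0; case: b {e}.
by rewrite mulr1; case: b b' {e} => -[].
Qed.

Lemma norm1_vec (a : 'I_d * bool) : norm1 (vec a) = 1.
Proof.
rewrite /norm1 (bigD1 a.1) //= big1 ?addr0 => [|i /negPf ia].
  by rewrite /vec !mxE !eqxx mulr1; case: a.2.
by rewrite /vec !mxE ia mulr0 normr0.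
Qed.

Lemma norm1_eq1 (v : lattice d) : norm1 v = 1 -> exists a, vec a = v.
Proof.
move=> v1; have [i vi] : exists i, v 0 i != 0.
  apply: contrapT => v0; move: v1; rewrite /norm1 big1 // => i _.
  by apply/eqP; rewrite normr_eq0; apply/negPn/negP => vi; apply: v0; exists i.
move: v1; rewrite /norm1 (bigD1 i) //=; set S := \sum_(_ < _ | _) _ => v1.
have S0 : 0 <= S by exact: sumr_ge0.
have {}S0 : S = 0 by move: vi v1; lia.
have vj j : j != i -> v 0 j = 0.
  by move=> ji; apply/eqP; rewrite -normr_eq0; apply/eqP; apply: (psumr_eq0P _ S0).
exists (i, v 0 i < 0); apply/rowP => j; rewrite /vec !mxE eqxx /=.
have [->|ji] := eqVneq j i; last by rewrite (vj j) ?mulr0.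
by rewrite mulr1; move: v1; rewrite S0 addr0; case: ltP => /=; lia.
Qed.

Lemma disp_take_cat s i j : (i <= j)%N ->
  disp (take j s) = disp (take i s) + disp (drop i (take j s)).
Proof.
by move=> ij; rewrite -[in LHS](cat_take_drop i (take j s)) disp_cat take_takel.
Qed.

Lemma path_of_word_step n s (a0 : 'I_d * bool) (j : 'I_n) : size s = n ->
  path_of_word n s (lift ord0 j) - path_of_word n s (widen_ord (leqnSn n) j)
    = vec (nth a0 s j).
Proof.
move=> es; rewrite !ffunE lift0 /= (take_nth a0) ?es //.
by rewrite -cats1 disp_cat addrC addrA addNr add0r disp_cons disp_nil addr0.
Qed.

Lemma path_of_word_nn n s : size s = n -> nearest_neighbour (path_of_word n s).
Proof.
move=> es j; have a0 : 'I_d * bool.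
  by case: s es => [e|a s _]; [case: j; rewrite -e | exact: a].
by rewrite (path_of_word_step a0) // norm1_vec.
Qed.

Lemma path_of_word0 n s : path_of_word n s ord0 = 0.
Proof. by rewrite ffunE take0 disp_nil. Qed.

Lemma path_of_word_max n s : size s = n -> path_of_word n s ord_max = disp s.
Proof. by move=> es; rewrite ffunE take_oversize ?es. Qed.

Lemma path_of_word_inj n s s' : size s = n -> size s' = n ->
  path_of_word n s = path_of_word n s' -> s = s'.
Proof.
move=> es es' e; have [n0|n0] := posnP n.
  by rewrite n0 in es es'; rewrite (size0nil es) (size0nil es').
have a0 : 'I_d * bool by case: s es {e} => [e|a s _]; [rewrite -e in n0 | exact: a].
apply: (@eq_from_nth _ a0) => [|j]; first by rewrite es'.
rewrite es => jn; apply: vec_inj.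
by rewrite -!(@path_of_word_step n _ a0 (Ordinal jn)) // e.
Qed.

Lemma path_of_word_surj n (w : path_of d n) : nearest_neighbour w -> w ord0 = 0 ->
  exists2 s, size s = n & path_of_word n s = w.
Proof.
move=> nn w0; have /choice[f hf] j := norm1_eq1 (nn j).
have es : size [seq f j | j <- enum 'I_n] = n by rewrite size_map size_enum_ord.
exists [seq f j | j <- enum 'I_n] => //; apply/ffunP => -[i i_lt].
elim: i i_lt => [|i IHi] i_lt.
  by rewrite (_ : Ordinal _ = ord0) ?path_of_word0 //; exact/val_inj.
have i_n : (i < n)%N by [].
have a0 := f (Ordinal i_n).
rewrite (_ : Ordinal _ = lift ord0 (Ordinal i_n)); last exact/val_inj.
have ew : widen_ord (leqnSn n) (Ordinal i_n) = Ordinal (ltnW i_lt) by exact/val_inj.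
have := path_of_word_step a0 (Ordinal i_n) es.
rewrite ew IHi (nth_map (Ordinal i_n)) ?size_enum_ord //.
rewrite (_ : nth _ _ _ = Ordinal i_n); last by apply/val_inj; rewrite /= nth_enum_ord.
by rewrite hf ew => /addIr.
Qed.

(** Sites i < j coincide exactly when the factor between them is closed. *)
Lemma path_of_word_injective n s : size s = n ->
  injective (path_of_word n s) <-> saw s.
Proof.
move=> es; split=> [inj p u q e u0|ss].
  have pn : (size p < n.+1)%N by rewrite -es e !size_cat; lia.
  have pun : (size (p ++ u) < n.+1)%N by rewrite -es e !size_cat; lia.
  have : Ordinal pn = Ordinal pun.
    apply: inj; rewrite !ffunE /= e {1}take_size_cat // catA take_size_cat //.
    by rewrite disp_cat u0 addr0.
  by case; rewrite size_cat => h; apply: size0nil; lia.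
have lt_neq (i j : 'I_n.+1) : (i < j)%N -> path_of_word n s i <> path_of_word n s j.
  move=> ij; rewrite !ffunE (disp_take_cat s (ltnW ij)) => /eqP.
  rewrite eq_sym -subr_eq0 addrC addKr => /eqP h.
  have := ss (take i s) (drop i (take j s)) (drop j s) _ h.
  rewrite catA -{1}(take_takel s (ltnW ij)) !cat_take_drop => /(_ erefl)/(congr1 size).
  have jn : (j <= n)%N by rewrite -ltnS.
  by rewrite size_drop size_takel /= ?es //; lia.
move=> i j e; apply/val_inj; have [||//] := ltngtP i j.
  by move=> /lt_neq/(_ e).
by move=> /lt_neq/(_ (esym e)).
Qed.

Lemma path_of_word_return m s : size s = m ->
  self_avoiding_return (path_of_word m s) <-> return_word s.
Proof.
move=> es; split=> [[nn _ wm inj]|[s0 ss]].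
  split=> [|p u q e u0]; first by rewrite -wm path_of_word_max.
  have [->|u_n0] := eqVneq u [::]; [by left|right].
  have pn : (size p < m.+1)%N by rewrite -es e !size_cat; lia.
  have pun : (size (p ++ u) < m.+1)%N by rewrite -es e !size_cat; lia.
  have eij : path_of_word m s (Ordinal pn) == path_of_word m s (Ordinal pun).
    rewrite !ffunE /= e {1}take_size_cat // catA take_size_cat //.
    by rewrite disp_cat u0 addr0.
  have ij : (size p < size (p ++ u))%N.
    by rewrite size_cat; case: (u) u_n0 => //= *; lia.
  have [/eqP[p0 pm]|ne] := boolP ((Ordinal pn, Ordinal pun) == (ord0, ord_max)).
    split; first exact: size0nil.
    by apply: size0nil; move: pm; rewrite -es e !size_cat; lia.
  by have := inj (Ordinal pn) (Ordinal pun) ij ne; rewrite eij.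
split.
- exact: path_of_word_nn.
- exact: path_of_word0.
- by rewrite path_of_word_max.
move=> i j ij ne; apply/negP; rewrite !ffunE (disp_take_cat s (ltnW ij)).
rewrite eq_sym -subr_eq0 addrC addKr => /eqP h.
have jm : (j <= m)%N by rewrite -ltnS.
have [||[p0 q0]] := ss (take i s) (drop i (take j s)) (drop j s) _ h.
- by rewrite catA -{1}(take_takel s (ltnW ij)) !cat_take_drop.
- by move=> /(congr1 size); rewrite size_drop size_takel /= ?es //; lia.
move: ne; rewrite xpair_eqE => /negP; apply; apply/andP; split; apply/eqP/val_inj => /=.
- by have := congr1 size p0; rewrite size_takel /= ?es //; lia.
- by have := congr1 size q0; rewrite size_drop /= es; lia.
Qed.

(** Exhibiting the set as the range of a list proves it finite, so [fset_set] does enumerate it. *)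
Lemma card_fset_set_paths n (Q : path_of d n -> Prop) (P : word -> Prop) :
  (forall w, Q w -> nearest_neighbour w /\ w ord0 = 0) ->
  (forall s, size s = n -> Q (path_of_word n s) <-> P s) ->
  #|` fset_set [set w | Q w]%classic| = wcount P n.
Proof.
move=> Qnn QP.
have -> : [set w | Q w]%classic = [set` map (path_of_word n) (words P n)]%classic.
  apply/seteqP; split=> w /=.
    move=> Qw; have [nn w0] := Qnn w Qw; have [s es ew] := path_of_word_surj nn w0.
    by apply/mapP; exists s => //; apply/wordsP; split=> //; apply/(QP _ es); rewrite ew.
  by case/mapP => s /wordsP[es Ps] ->; apply/(QP _ es).
rewrite fset_set_seq /= card_fseq undup_id ?size_map // map_inj_in_uniq ?words_uniq //.
by move=> s s' /wordsP[es _] /wordsP[es' _]; exact: path_of_word_inj.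
Qed.

Lemma saw_countE n : saw_count d n = wcount (@saw d) n.
Proof.
apply: card_fset_set_paths => [w [[nn _] w0] //|s es].
split=> [[[_ inj] _]|ss]; first exact/(path_of_word_injective es).
split; last exact: path_of_word0.
by split; [exact: path_of_word_nn | exact/path_of_word_injective].
Qed.

Lemma saw_count_toE n x : saw_count_to n x = wcount (ends_at x (@saw d)) n.
Proof.
apply: card_fset_set_paths => [w [[nn _] w0 _] //|s es].
split=> [[[_ inj] _ wx]|[ss sx]].
  by split; [exact/(path_of_word_injective es) | rewrite -wx path_of_word_max].
split; [|exact: path_of_word0|by rewrite path_of_word_max].
by split; [exact: path_of_word_nn | exact/path_of_word_injective].
Qed.

(** * Polygons as classes of returns *)

Lemma same_polygon_refl m (w : path_of d m) : (0 < m)%N ->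
  self_avoiding_return w -> same_polygon w w.
Proof.
move=> m0 [_ w0 wm _]; exists 0%N, 0; left=> i; rewrite addr0 add0n.
have [im|] := ltnP i m; first by rewrite modn_small // inord_val.
move=> mi; have im : nat_of_ord i = m by have := ltn_ord i; lia.
rewrite im modnn (_ : i = ord_max) ?wm; last exact/val_inj.
by rewrite (_ : inord 0 = ord0) ?w0 //; apply/val_inj; rewrite /= inordK.
Qed.

Lemma polygon_countE m :
  polygon_count d m = size (undup [seq polygon_class (path_of_word m s) |
                                   s <- words (@return_word d) m]).
Proof.
rewrite /polygon_count -card_fseq -fset_set_seq; congr (#|` fset_set _|).
apply/seteqP; split=> C /=.
  case=> w rw <-; case: (rw) => nn w0 _ _.
  have [s es ew] := path_of_word_surj nn w0.
  apply/mapP; exists s; last by rewrite ew.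
  by apply/wordsP; split=> //; apply/(path_of_word_return es); rewrite ew.
case/mapP => s /wordsP[es rs] ->; exists (path_of_word m s) => //.
exact/(path_of_word_return es).
Qed.

Lemma polygon_count_le m : (polygon_count d m <= wcount (@return_word d) m)%N.
Proof.
rewrite polygon_countE /wcount -(size_map (fun s => polygon_class (path_of_word m s))).
exact: size_undup.
Qed.

(** A class has at most 2 m members: a return is fixed by a representative, a root modulo m and a
    direction. *)
Lemma wcount_return_le_polygon m : (0 < m)%N ->
  (wcount (@return_word d) m <= polygon_count d m * (m * 2))%N.
Proof.
move=> m0; rewrite polygon_countE.
set cls := fun s => polygon_class _; set L := [seq _ | s <- _].
pose rep C := path_of_word m (nth [::] (words (@return_word d) m) (index C L)).
pose moved C (kb : nat * bool) : path_of d m :=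
  let f i := if kb.2 then i else (m - i)%N in
  [ffun i : 'I_m.+1 => rep C (inord ((kb.1 + f i) %% m))
                       - rep C (inord ((kb.1 + f 0%N) %% m))].
have -> : (m * 2 = size [seq (i, b) | i <- iota 0 m, b <- [:: true; false]])%N.
  by rewrite size_allpairs size_iota.
rewrite -(size_allpairs moved) /wcount.
rewrite -(size_map (path_of_word m)); apply: uniq_leq_size.
  rewrite map_inj_in_uniq ?words_uniq // => s s' /wordsP[es _] /wordsP[es' _].
  exact: path_of_word_inj.
move=> w /mapP[s sw ew]; have [es rs] := wordsP _ _ _ sw.
have rw : self_avoiding_return w by rewrite ew; exact/(path_of_word_return es).
have w0 : w ord0 = 0 by case: rw.
have CL : polygon_class w \in L by apply/mapP; exists s; rewrite // ew.
have [k [x same]] : same_polygon (rep (polygon_class w)) w.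
  suff : polygon_class (rep (polygon_class w)) w by case.
  have -> : polygon_class (rep (polygon_class w)) = polygon_class w.
    rewrite /rep -[RHS](nth_index set0 CL) (nth_map [::]) //.
    by rewrite -(size_map cls) index_mem.
  by split=> //; exact: same_polygon_refl.
pose kb (b : bool) := ((k %% m)%N, b).
have kbL b : kb b \in [seq (i, b) | i <- iota 0 m, b <- [:: true; false]].
  apply/allpairsP; exists (kb b); split=> //; first by rewrite mem_iota /= ltn_mod.
  by case: b.
(* Since [w] starts at 0, the translation is forced to be minus the site where reading begins. *)
have at0 (f : nat -> nat) : (forall i : 'I_m.+1, w i = rep (polygon_class w)
    (inord ((k + f i) %% m)) + x) -> forall i : 'I_m.+1,
    w i = rep (polygon_class w) (inord ((k %% m + f i) %% m))
      - rep (polygon_class w) (inord ((k %% m + f 0) %% m)).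
  move=> h i; have := h ord0; rewrite w0 => /esym/eqP; rewrite addrC addr_eq0 => /eqP ex.
  by rewrite h ex !modnDml.
apply/allpairsP; case: same => [/(at0 id)|/(at0 (fun i => m - i)%N)] h.
- exists (polygon_class w, kb true); split; [by rewrite mem_undup | exact: kbL |].
  by apply/ffunP => i; rewrite h [RHS]ffunE.
- exists (polygon_class w, kb false); split; [by rewrite mem_undup | exact: kbL |].
  by apply/ffunP => i; rewrite h [RHS]ffunE.
Qed.
End Paths.

(** * The connective constant *)

Section Subadditive.
Local Open Scope classical_set_scope.
Variable R : realType.
Implicit Types u : nat -> R.

(** The limit is the infimum of u n / n over n >= 1. For the upper estimate, divide n by an m that
    nearly attains the infimum; K bounds the contribution of every remainder. *)
Lemma fekete u : (forall n, 0 <= u n) -> (forall m n, u (m + n)%N <= u m + u n) ->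
  exists l : R, ((fun n => u n / n%:R) @ \oo --> l) /\
    forall n, l * n%:R <= u n.
Proof.
move=> u0 sub; pose E : set R := [set u n.+1 / n.+1%:R | n in [set: nat]]%classic.
have Einf : has_inf E.
  split; first by exists (u 1%N / 1%:R), 0%N.
  by exists 0 => _ [n _ <-]; rewrite divr_ge0.
have l_le n : inf E * n%:R <= u n.
  case: n => [|n]; first by rewrite mulr0.
  by rewrite -ler_pdivlMr ?ltr0n //; apply: ge_inf; [case: Einf | exists n].
exists (inf E); split=> //.
have mul q m r : u (q * m + r)%N <= q%:R * u m + u r.
  elim: q => [|q IHq]; first by rewrite mul0r add0r.
  rewrite mulSn -addnA -natr1 mulrDl mul1r addrAC addrC.
  by apply: le_trans (sub _ _) _; rewrite lerD2l.
apply/cvgrPdist_le => e e0.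
have e2 : 0 < e / 2 by rewrite divr_gt0.
have [_ [p _ <-] hp] := inf_adherent e2 Einf; set m := p.+1 in hp.
pose K := \sum_(r < m) u r.
have K0 : 0 <= K by exact: sumr_ge0.
near=> n.
have n0 : 0 < n%:R :> R by rewrite ltr0n; near: n; exact: nbhs_infty_gt.
have Kn : K <= e / 2 * n%:R.
  rewrite -ler_pdivrMl // mulrC; near: n; exact: nbhs_infty_ger.
have un : u n <= (u m / m%:R) * n%:R + K.
  rewrite {1}(divn_eq n m); apply: le_trans (mul _ _ _) _; apply: lerD; last first.
    rewrite /K (bigD1 (Ordinal (ltn_pmod n (ltn0Sn p)))) //= lerDl.
    exact: sumr_ge0.
  rewrite mulrAC ler_pdivlMr ?ltr0n // mulrAC -natrM mulrC ler_wpM2l // ler_nat.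
  exact: leq_trunc_div.
rewrite ler_distlC; apply/andP; split; last first.
  rewrite ler_pdivrMr //; apply: le_trans un _.
  have := ltW hp; rewrite -(ler_pM2r n0) => h; nra.
rewrite ler_pdivlMr //; apply: le_trans (l_le n).
by rewrite ler_wpM2r // ?gerBl ltW.
Unshelve. all: by end_near.
Qed.

(** Absorbs polynomial factors into the exponential error: n + 1 <= (1 + sqrt n) ^ 2 <= exp (2 sqrt
    n). *)
Lemma expR_sqrt_ge n k : n.+1%:R ^+ k <= expR ((2 * k)%:R * Num.sqrt n%:R) :> R.
Proof.
rewrite -[X in expR X](_ : k%:R * (2 * Num.sqrt n%:R) = _); last by rewrite natrM; ring.
rewrite expRM_natl lerXn2r ?nnegrE ?expR_ge0 //.
have s0 : 0 <= Num.sqrt n%:R :> R by exact: sqrtr_ge0.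
have ss : Num.sqrt n%:R ^+ 2 = n%:R :> R by rewrite sqr_sqrtr.
have -> : expR (2 * Num.sqrt n%:R) = expR (Num.sqrt n%:R) ^+ 2 :> R by rewrite -expRM_natl.
apply: le_trans (_ : (1 + Num.sqrt n%:R) ^+ 2 <= _).
  rewrite sqrrD ss expr1n mul1r -natr1 addrAC [leRHS]addrC addrA; nra.
by rewrite lerXn2r ?nnegrE ?expR_ge0 ?expR_ge1Dx ?addr_ge0.
Qed.

Lemma powR_root_cvg (f : nat -> nat) (mu C : R) : 0 < mu -> 0 < C ->
  (forall n, (1 < n)%N ->
     mu ^+ (2 * n) * expR (- C * Num.sqrt n%:R) <= (f n)%:R
       <= mu ^+ (2 * n) * expR (C * Num.sqrt n%:R)) ->
  (fun n => (f n)%:R `^ (2 * n)%:R^-1 : R) @ \oo --> mu.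
Proof.
move=> mu0 C0 hf.
have h : (fun n => ln (f n)%:R / (2 * n)%:R : R) @ \oo --> ln mu.
  apply/cvgrPdist_le => e e0; near=> n.
  have n1 : (1 < n)%N by near: n; exact: nbhs_infty_gt.
  have n0 : 0 < n%:R :> R by rewrite ltr0n ltnW.
  have s0 : 0 < Num.sqrt n%:R :> R by rewrite sqrtr_gt0.
  have ss : Num.sqrt n%:R ^+ 2 = n%:R :> R by rewrite sqr_sqrtr // ltW.
  have Cs : C * Num.sqrt n%:R <= e * (2 * n)%:R.
    (* This threshold makes C / e <= sqrt n, hence the error C sqrt n is at most e n. *)
    have : (C / e) ^+ 2 <= n%:R by near: n; exact: nbhs_infty_ger.
    rewrite -[X in _ <= X]ss ler_sqr ?nnegrE; [|by rewrite divr_ge0 ?ltW|exact: ltW].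
    rewrite ler_pdivrMr // natrM -[X in _ * (_ * X)]ss => h1; nra.
  have /andP[lo hi] := hf n n1.
  have f0 : 0 < (f n)%:R :> R by apply: lt_le_trans lo; rewrite mulr_gt0 ?exprn_gt0 ?expR_gt0.
  have lnE x : ln (mu ^+ (2 * n) * expR x) = (2 * n)%:R * ln mu + x.
    by rewrite lnM ?posrE ?exprn_gt0 ?expR_gt0 // lnXn // expRK mulr_natl.
  have n20 : 0 < (2 * n)%:R :> R by rewrite ltr0n; lia.
  move: lo hi; rewrite -ler_ln ?posrE ?mulr_gt0 ?exprn_gt0 ?expR_gt0 // lnE => lo.
  rewrite -ler_ln ?posrE ?mulr_gt0 ?exprn_gt0 ?expR_gt0 // lnE => hi.
  rewrite ler_distlC ler_pdivlMr // ler_pdivrMr //; apply/andP; split; nra.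
have {}h : expR (ln (f n)%:R / (2 * n)%:R) @[n --> \oo] --> expR (ln mu).
  by apply: continuous_cvg h; exact: continuous_expR.
rewrite lnK ?posrE // in h; apply: cvg_trans h; apply: near_eq_cvg; near=> n.
have n1 : (1 < n)%N by near: n; exact: nbhs_infty_gt.
have /andP[lo _] := hf n n1.
have f0 : 0 < (f n)%:R :> R by apply: lt_le_trans lo; rewrite mulr_gt0 ?exprn_gt0 ?expR_gt0.
by rewrite /powR gt_eqF // mulrC.
Unshelve. all: by end_near.
Qed.
End Subadditive.

Section ConnectiveConstant.
Local Open Scope classical_set_scope.
Variables (R : realType) (d : nat).
Hypothesis hd : (2 <= d)%N.
Local Notation word := (seq ('I_d * bool)).
Local Notation mu := (connective_constant R d).
Local Notation k0 := (Ordinal (ltnW hd)).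
Local Notation k1 := (Ordinal hd).

Lemma saw_nseq (k : 'I_d) n : saw (nseq n (k, false)).
Proof.
have h s : all (pred1 (k, false)) s -> ht (coord k) s = size s.
  elim: s => [|a s IHs]; first by rewrite ht_nil.
  by case/andP => /eqP -> /IHs /= hs; rewrite ht_cons hs /coord eqxx expr0 mul1r.
move=> p u q e /(ht0 (coord k)); rewrite h => [[]|]; first exact: size0nil.
by have := all_pred1_nseq (k, false) n; rewrite e !all_cat => /and3P[].
Qed.

Lemma wcount_saw_gt0 n : (0 < wcount (@saw d) n)%N.
Proof.
have : nseq n (k0, false) \in words (@saw d) n.
  by apply/wordsP; rewrite size_nseq; split=> //; exact: saw_nseq.
by rewrite /wcount; case: (words _ _).
Qed.

(** Logarithms of the walk counts are subadditive. This shows that the [limn] defining mu is a true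
    limit and that mu ^ n bounds the counts from below. *)
Lemma connective_constantE : exists l : R,
  [/\ (fun n => ln (wcount (@saw d) n)%:R / n%:R : R) @ \oo --> l,
      mu = expR l & forall n, mu ^+ n <= (wcount (@saw d) n)%:R].
Proof.
have c0 n : 0 < (wcount (@saw d) n)%:R :> R by rewrite ltr0n wcount_saw_gt0.
have [||l [cl l_le]] := @fekete R (fun n => ln (wcount (@saw d) n)%:R).
- by move=> n; rewrite ln_ge0 // ler1n wcount_saw_gt0.
- move=> m n; rewrite -lnM ?posrE // ler_ln ?posrE ?mulr_gt0 //.
  by rewrite -natrM ler_nat wcount_saw_mul.
have muE : mu = expR l.
  apply/cvg_lim => //.
  rewrite (_ : (fun n => (saw_count d n)%:R `^ _) =
    fun n => expR (ln (wcount (@saw d) n)%:R / n%:R)).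
    by apply: continuous_cvg cl; exact: continuous_expR.
  by apply/funext => n /=; rewrite saw_countE /powR gt_eqF // mulrC.
exists l; split=> // n; rewrite muE -expRM_natl -[leRHS]lnK ?posrE //.
by rewrite ler_expR mulrC.
Qed.

Lemma connective_constant_gt0 : 0 < mu.
Proof. by have [l [_ -> _]] := connective_constantE; exact: expR_gt0. Qed.

Lemma exprn_connective_constant_le n : mu ^+ n <= (wcount (@saw d) n)%:R.
Proof. by have [l [_ _]] := connective_constantE. Qed.

(** The power a(n) ^ (k + 1) is at most the number of walks of length (k + 1) n; take roots and let
    k grow. *)
Lemma supermul_le_connective_constant (a : nat -> nat) n : (0 < n)%N ->
  (forall i j, (a i * a j <= a (i + j))%N) ->
  (forall m, (a m <= wcount (@saw d) m)%N) ->
  (a n)%:R <= mu ^+ n.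
Proof.
move=> n0 sup ac; have [l [cl muE _]] := connective_constantE.
have [->|an0] := posnP (a n); first by rewrite exprn_ge0 // ltW // connective_constant_gt0.
have ak k : (a n ^ k.+1 <= wcount (@saw d) (k.+1 * n))%N.
  apply: leq_trans (ac _); elim: k => [|k IHk]; first by rewrite mul1n expn1.
  by rewrite expnS mulSn; apply: leq_trans (sup _ _); rewrite leq_mul2l IHk orbT.
have nR : 0 < n%:R :> R by rewrite ltr0n.
rewrite muE -expRM_natl -[leLHS]lnK ?posrE ?ltr0n // ler_expR mulrC -ler_pdivrMr //.
apply/ler_addgt0Pr => e e0.
have /cvgrPdist_le/(_ e e0)[N _ hN] := cl.
have /= := hN (N.+1 * n)%N; rewrite ler_distlC => /(_ _)/andP[|_]; first by nia.
apply: le_trans; rewrite natrM invfM mulrA ler_pM2r ?invr_gt0 //.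
rewrite ler_pdivlMr ?ltr0n // mulrC mulr_natl -lnXn ?ltr0n // -natrX.
by rewrite ler_ln ?posrE ?ltr0n ?expn_gt0 ?an0 ?wcount_saw_gt0 // ler_nat.
Qed.

Lemma e1E : e1 d = vec (k0, false).
Proof. by apply/rowP => i; rewrite /vec !mxE expr0 mul1r. Qed.

Local Notation c1 := (wcount (@saw d) 1)%:R.

(** A crude bound from mu <= c1 <= exp c1, used to pay for replacing n - 1 by n in the exponent of
    mu. *)
Lemma sqr_connective_constant_le n : (0 < n)%N ->
  mu ^+ 2 <= expR (2 * c1 * Num.sqrt n%:R).
Proof.
move=> n0; have m0 := ltW connective_constant_gt0.
rewrite -mulrA expRM_natl lerXn2r ?nnegrE ?expR_ge0 //.
have := exprn_connective_constant_le 1; rewrite expr1 => /le_trans; apply.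
apply: (@le_trans _ _ (expR c1)); first by apply: le_trans (expR_ge1Dx _); rewrite lerDr.
by rewrite ler_expR ler_peMr // -[leLHS]sqrtr1 ler_wsqrtr // ler1n.
Qed.

(** In the constant, 2 c1 pays for mu ^ 2, 8 for the squared factor exp (4 sqrt n), and 8 d + 8 for
    n ^ 2 (n + 1) ^ (4 d + 2) <= (n + 1) ^ (4 d + 4). *)
Lemma saw_count_to_e1_ge n : (0 < n)%N ->
  mu ^+ (2 * n) * expR (- (2 * c1 + 8 * d%:R + 16) * Num.sqrt n%:R)
    <= (saw_count_to (2 * n + 1) (e1 d))%:R.
Proof.
move=> n0; rewrite saw_count_toE e1E; set w := wcount (ends_at _ _) _.
set r := Num.sqrt _; rewrite mulNr expRN -ler_pdivlMr ?invr_gt0 ?expR_gt0 // invrK.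
have := wcount_bridge_sq (isT : k0 != k1) n0; rewrite -/w.
set b := wcount _ n => bw.
(* Bridges of length n control walks of length n - 1, because of the extra step. *)
have mub : mu ^+ n.-1 <= n%:R * expR (4 * r) * b%:R.
  apply: le_trans (exprn_connective_constant_le _) _.
  by have := wcount_saw_le_bridge R k1 n.-1; rewrite prednK.
have -> : mu ^+ (2 * n) = mu ^+ 2 * (mu ^+ n.-1) ^+ 2.
  by rewrite -exprM -exprD; congr (_ ^+ _); lia.
apply: le_trans (_ : expR (2 * c1 * r) * (n%:R * expR (4 * r) * b%:R) ^+ 2 <= _).
  have m0 := ltW connective_constant_gt0.
  apply: ler_pM; rewrite ?exprn_ge0 ?sqr_connective_constant_le //.
  by rewrite lerXn2r ?nnegrE ?exprn_ge0 // ?mulr_ge0 ?expR_ge0.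
rewrite !exprMn -!natrX -expRM_natl.
have nb : (n ^ 2)%:R * (b ^ 2)%:R <= expR ((2 * (4 * d + 4))%:R * r) * w%:R :> R.
  apply: le_trans (_ : n.+1%:R ^+ (4 * d + 4) * w%:R <= _); last first.
    by rewrite ler_wpM2r // expR_sqrt_ge.
  rewrite -natrX -!natrM ler_nat (_ : 4 * d + 4 = 2 + (4 * d + 2))%N; last by lia.
  rewrite expnD -mulnA; apply: leq_mul; first by rewrite leq_exp2r.
  exact: bw.
have -> : (2 * c1 + 8 * d%:R + 16) * r = 2 * c1 * r + (2 * (4 * r) + (2 * (4 * d + 4))%:R * r).
  by rewrite !natrM natrD natrM; ring.
rewrite 2!expRD.
set eA := expR (2 * c1 * r); set eB := expR (2 * (4 * r)); set eD := expR (_%:R * r).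
have -> : eA * ((n ^ 2)%:R * eB * (b ^ 2)%:R) = eA * eB * ((n ^ 2)%:R * (b ^ 2)%:R) by ring.
have -> : w%:R * (eA * (eB * eD)) = eA * eB * (eD * w%:R) by ring.
by rewrite ler_wpM2l // mulr_ge0 ?expR_ge0.
Qed.

(** The functional varies with m, but bridge counts are at most mu ^ m for every functional. *)
Lemma wcount_return_le m : (1 < m)%N -> (wcount (@return_word d) m)%:R <= m%:R * mu ^+ m.
Proof.
move=> m1; have [c sep] := separating_functional d m.
apply: le_trans (_ : (m * wcount (bridge c) m)%:R <= _).
  by rewrite ler_nat wcount_return_le_bridge.
rewrite natrM ler_wpM2l //; apply: supermul_le_connective_constant; first lia.
  by move=> i j; exact: wcount_bridge_mul.
by move=> n; apply: wcount_le => s es [ss _ _]; apply/wordsP.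
Qed.

Lemma saw_count_to_e1_le n :
  (saw_count_to (2 * n + 1) (e1 d))%:R <= (n + 1)%:R * mu ^+ (2 * n + 2).
Proof.
rewrite saw_count_toE e1E -(ler_pM2l (ltr0n R 2)) -natrM mulrA -natrM.
have n1 : (1 < (2 * n + 1).+1)%N by lia.
have := wcount_return_le n1; rewrite (_ : 2 * n + 2 = (2 * n + 1).+1)%N; last by lia.
rewrite (_ : 2 * (n + 1) = (2 * n + 1).+1)%N; last by lia.
by apply: le_trans; rewrite ler_nat wcount_saw_le_return.
Qed.

(** To the constant for walks ending at e1, add 2 c1 for another mu ^ 2 and 4 for the at most 4 n
    returns per polygon, as 4 n <= (n + 1) ^ 2 <= exp (4 sqrt n). *)
Lemma polygon_count_bounds n (C : R := 4 * c1 + 8 * d%:R + 20) : (1 < n)%N ->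
  mu ^+ (2 * n) * expR (- C * Num.sqrt n%:R) <= (polygon_count d (2 * n))%:R
    <= mu ^+ (2 * n) * expR (C * Num.sqrt n%:R).
Proof.
move=> n1; set r := Num.sqrt _; set q := polygon_count d _.
have r0 : 0 <= r by exact: sqrtr_ge0.
have m0 := ltW connective_constant_gt0.
have n4 : (4 * n)%:R <= expR (4 * r) :> R.
  apply: le_trans (expR_sqrt_ge _ n 2); rewrite -natrX ler_nat; nia.
apply/andP; split; last first.
  apply: le_trans (_ : (wcount (@return_word d) (2 * n))%:R <= _).
    by rewrite ler_nat polygon_count_le.
  apply: le_trans (wcount_return_le _) _; first lia.
  rewrite mulrC ler_wpM2l ?exprn_ge0 //.
  apply: le_trans (_ : (4 * n)%:R <= _); first by rewrite ler_nat; lia.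
  apply: le_trans n4 _; rewrite ler_expR ler_wpM2r // /C.
  have : 0 <= c1 :> R by []. have : 0 <= d%:R :> R by []. lra.
rewrite mulNr expRN -ler_pdivlMr ?invr_gt0 ?expR_gt0 // invrK.
have lo : mu ^+ (2 * n.-1) * expR (- (2 * c1 + 8 * d%:R + 16) * r) <= q%:R * expR (4 * r).
  apply: le_trans (_ : (wcount (@return_word d) (2 * n))%:R <= _); last first.
    apply: le_trans (_ : (q * (2 * n * 2))%:R <= _).
      by rewrite ler_nat wcount_return_le_polygon //; lia.
    rewrite natrM ler_wpM2l //; apply: le_trans n4; rewrite ler_nat; lia.
  apply: le_trans (_ : (saw_count_to (2 * n.-1 + 1) (e1 d))%:R <= _); last first.
    rewrite ler_nat saw_count_toE e1E.
    have := wcount_saw_le_return (k0, false) (2 * n.-1 + 1).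
    by rewrite (_ : (2 * n.-1 + 1).+1 = 2 * n)%N; lia.
  apply: le_trans (saw_count_to_e1_ge _); last by lia.
  rewrite ler_wpM2l ?exprn_ge0 // ler_expR !mulNr lerN2 ler_wpM2l //.
  by rewrite ler_wsqrtr // ler_nat; lia.
have -> : mu ^+ (2 * n) = mu ^+ 2 * mu ^+ (2 * n.-1) by rewrite -exprD; congr (_ ^+ _); lia.
move: lo; rewrite mulNr expRN -ler_pdivlMr ?invr_gt0 ?expR_gt0 // invrK => lo.
apply: le_trans (ler_pM _ _ (sqr_connective_constant_le (ltnW n1)) lo) _; rewrite ?exprn_ge0 //.
have -> : C * r = 2 * c1 * r + (4 * r + (2 * c1 + 8 * d%:R + 16) * r) by rewrite /C; ring.
rewrite 2!expRD -/r; set eA := expR (2 * c1 * r); set eB := expR (4 * r); set eD := expR _.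
by have -> : q%:R * (eA * (eB * eD)) = eA * (q%:R * eB * eD) by ring.
Qed.
End ConnectiveConstant.

Theorem corollary2p10 (R : realType) (d : nat) (hd : (2 <= d)%N) :
  (exists2 C : R, 0 < C &
     forall n : nat, (1 <= n)%N ->
       connective_constant R d ^+ (2 * n) * expR (- C * Num.sqrt n%:R)
         <= (saw_count_to (2 * n + 1) (e1 d))%:R
         <= (n + 1)%:R * connective_constant R d ^+ (2 * n + 2))
  /\ polygon_connective_constant R d = connective_constant R d.
Proof.
split.
  exists (2 * (wcount (@saw d) 1)%:R + 8 * d%:R + 16).
    by rewrite ltr_wpDl // addr_ge0 // mulr_ge0.
  by move=> n n1; rewrite (saw_count_to_e1_ge R hd n1) saw_count_to_e1_le.
apply/cvg_lim => //; apply: powR_root_cvg (polygon_count_bounds R hd).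
  exact: connective_constant_gt0.
by rewrite ltr_wpDl // addr_ge0 // mulr_ge0.
Qed.
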